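(* Let $z\in(0,1-1/\sqrt2)$, $M>0$, $a>0$, $b,c\ge0$, and $\tau=4(2+cz)/(az^2)$. Let $\{\Delta_m,\ m\in\mathcal M\}$ be such that $\Sigma=\sum_{m\in\mathcal M}e^{-\Delta_m}<+\infty$ and $\Delta_m\ge1$ for all $m\in\mathcal M$. Assume that: (1) for all $y,\xi>0$, $\displaystyle\sup_{t,t'\in\mathcal B(s,y)}\mathbb P[Z(N,t,t')>\xi]\le b\exp\left[-\frac{a\xi^2}{y^2+c\xi}\right]$; (2) $\{\mathcal S_m,\ m\in\mathcal M\}$ is a family of discrete subsets of $\mathcal L_0$ and for each $m\in\mathcal M$ there is $\eta_m\ge1/2$ such that for all $s'\in\mathcal L_0$ and all $r\ge2\eta_m$, $|\mathcal S_m\cap\mathcal B(s',r\sqrt\tau)|\le M\exp(r^2/2)$. Let $\mathcal S=\bigcup_{m\in\mathcal M}\mathcal S_m$ and let $\mathrm{pen}:\mathcal S\to\mathbb R_+$ satisfy $\mathrm{pen}(t)\ge z\tau\inf_{m\in\mathcal M(t)}(4\eta_m^2+\Delta_m)$ for all $t\in\mathcal S$, where $\mathcal M(t)=\{m\in\mathcal M:\ t\in\mathcal S_m\}$. Let $\tilde s=\hat s_{\hat\lambda}$ be the estimator obtained by the indirect selection procedure (described in the context). Then there are positive numbers $C,C'$ depending on $z$ only such that for all $\xi>0$, $$\mathbb P\left[H^2(s,\tilde s)\ge C\left[\inf_{\lambda\in\Lambda}\left(H^2(s,\hat s_\lambda)+A(\hat s_\lambda,\mathcal S)\right)+\tau\xi\right]\right]\le(bM^2\Sigma^2e^{-\xi})\wedge1,$$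 and $$C'\,\mathbb E[H^2(s,\tilde s)]\le\mathbb E\left[\inf_{\lambda\in\Lambda}\{H^2(s,\hat s_\lambda)+A(\hat s_\lambda,\mathcal S)\}\right]+\tau[(bM^2\Sigma^2)\vee1]$$ $$\le\inf_{\lambda\in\Lambda}\mathbb E\left[H^2(s,\hat s_\lambda)+A(\hat s_\lambda,\mathcal S)\right]+\tau[(bM^2\Sigma^2)\vee1].$$
   Context: Setting. $N_1,\dots,N_k$ are independent random measures on a probability space $(\Omega,\mathcal T,\mathbb P)$, $N_i$ taking values in the positive measures on a measured space $(\mathcal X_i,\mathcal A_i,\mu_i)$, with $\mathbb E[N_i(A)]=\int_A s_i\,d\mu_i<+\infty$ for all $A\in\mathcal A_i$, where $s_i\ge0$ is measurable. Write $N=(N_1,\dots,N_k)$, $s=(s_1,\dots,s_k)$, $\mu=(\mu_1,\dots,\mu_k)$. $\mathcal L$ is the set of $k$-tuples $t=(t_1,\dots,t_k)$ of nonnegative measurable functions with $t_i$ integrable on $(\mathcal X_i,\mathcal A_i,\mu_i)$; $\mathcal L_0\subset\mathcal L$ is a known subset containing $s$. All operations on $k$-tuples are componentwise, and $\int_{\mathcal X}f\,d\nu=\sum_{i=1}^k\int_{\mathcal X_i}f_i\,d\nu_i$. The loss is $H^2(t,t')=\frac12\int_{\mathcal X}(\sqrt t-\sqrt{t'})^2d\mu$ and $\mathcal B(t,y)=\{t'\in\mathcal L_0:H(t,t')\le y\}$. Notation. $\rho(t,t')=\int_{\mathcal X}\sqrt{tt'}\,d\mu$, $\rho_r(\nu,t)=\frac12\left[\rho(t,r)+\int_{\mathcal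 X}\sqrt{t/r}\,d\nu\right]$ (conventions $0/0=0$, $a/0=+\infty$ for $a>0$). $Z(N,t,t')=\int_{\mathcal X}\psi(t,t',x)\,dN-\int_{\mathcal X}\psi(t,t',x)\,s\,d\mu$, where (componentwise) $\psi(t,t',x)=\frac1{\sqrt2}\left[\sqrt{\frac1{1+t(x)/t'(x)}}-\sqrt{\frac1{1+t'(x)/t(x)}}\right]$. Models and estimators. $\{S_m,\ m\in\mathcal M\}$ is an at most countable family of nonvoid subsets of $\mathcal L_0$, $\mathbb S=\bigcup_mS_m$, and $\{\hat s_\lambda,\lambda\in\Lambda\}$ is an at most countable family of estimators (measurable functions of $N$) with values in $\mathbb S$. For $t\in\mathbb S$, $A(t,\mathcal S)=\inf_{t'\in\mathcal S}[H^2(t,t')+\mathrm{pen}(t')]$. Direct selection procedure, for a family of estimators $\{\tilde s_\lambda,\lambda\in\Lambda\}$ with values in $\mathcal S$. For $\tilde s_\lambda\ne\tilde s_{\lambda'}$ put, with $r=(\tilde s_\lambda+\tilde s_{\lambda'})/2$, $$\mathbf T(N,\tilde s_\lambda,\tilde s_{\lambda'})=\left[\rho_r(N,\tilde s_{\lambda'})-\tfrac12\int_{\mathcal X}\tilde s_{\lambda'}d\mu-\mathrm{pen}(\tilde s_{\lambda'})\right]-\left[\rho_r(N,\tilde s_\lambda)-\tfrac12\int_{\mathcal X}\tilde s_\lambda d\mu-\mathrm{pen}(\tilde s_\lambda)\right].$$ Let $\mathcal E(\tilde s_\lambda)$ be the set of those $\tilde s_{\lambda'}\neq\tilde s_\lambda$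 with $\mathbf T(N,\tilde s_\lambda,\tilde s_{\lambda'})\ge0$, and $\mathcal D(\tilde s_\lambda)=\sup\{H^2(\tilde s_\lambda,\tilde s_{\lambda'}):\tilde s_{\lambda'}\in\mathcal E(\tilde s_\lambda)\}$ ($=0$ if $\mathcal E(\tilde s_\lambda)=\varnothing$). Select any $\tilde\lambda\in\Lambda$ with $\mathcal D(\tilde s_{\tilde\lambda})\le\mathcal D(\tilde s_\lambda)+\tau$ for all $\lambda\in\Lambda$. Indirect selection procedure. To each $\lambda\in\Lambda$ associate $\tilde s_\lambda$, any element of $\mathcal S$ with $H^2(\hat s_\lambda,\tilde s_\lambda)+\mathrm{pen}(\tilde s_\lambda)\le A(\hat s_\lambda,\mathcal S)+\tau$. Select $\tilde\lambda$ by the direct selection procedure applied to $\{\tilde s_\lambda,\lambda\in\Lambda\}$. Finally $\hat\lambda$ is any element of $\Lambda$ such that $H^2(\hat s_{\hat\lambda},\tilde s_{\tilde\lambda})\le\inf_{\lambda\in\Lambda}H^2(\hat s_\lambda,\tilde s_{\tilde\lambda})+\tau$. *)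

(* Defs.v *)
From HB Require Import structures.
From mathcomp Require Import all_boot all_order all_algebra.
From mathcomp Require Import all_classical all_reals all_analysis.
From mathcomp Require Import measurable_realfun.

Set Implicit Arguments.
Unset Strict Implicit.
Unset Printing Implicit Defensive.

Import Order.TTheory GRing.Theory Num.Theory.
Import numFieldNormedType.Exports.

Local Open Scope classical_set_scope.
Local Open Scope ring_scope.

(* k-tuples (t_1, ..., t_k) of real functions, t_i being defined on X i.  They
   are genuine functions, not classes modulo equality almost everywhere. *)
Definition tuple_fun (R : realType) (k : nat) (d : 'I_k -> measure_display)
    (X : forall i, measurableType (d i)) : Type :=
  forall i : 'I_k, X i -> R.

Section intensities.
Context (R : realType) (k : nat) (d : 'I_k -> measure_display).
Context (X : forall i, measurableType (d i)).
Context (mu : forall i, {measure set (X i) -> \bar R}).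
Local Notation Tup := (tuple_fun R X).

Definition tuple_integral (nu : forall i, set (X i) -> \bar R)
    (f : forall i, X i -> \bar R) : \bar R :=
  (\sum_(i < k) \int[nu i]_x f i x)%E.

Definition intensities : set Tup :=
  [set t : Tup | forall i, [/\ measurable_fun setT (t i),
                         forall x, 0 <= t i x &
                         (mu i).-integrable setT (EFin \o t i)]].

Definition H2 (t t' : Tup) : \bar R :=
  ((2^-1)%:E *
   tuple_integral mu (fun i x => ((Num.sqrt (t i x) - Num.sqrt (t' i x)) ^+ 2)%:E))%E.

Definition Hdist (t t' : Tup) : \bar R := sqrte (H2 t t').

Definition Hball (L0 : set Tup) (t : Tup) (y : R) : set Tup :=
  [set t' | L0 t' /\ (Hdist t t' <= y%:E)%E].

(* Discreteness for the topology of (L0, H): every point of A is isolated. *)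
Definition Hdiscrete (L0 A : set Tup) : Prop :=
  forall t, A t -> exists2 e : R, 0 < e & A `&` Hball L0 t e = [set t].

Definition affinity (t t' : Tup) : \bar R :=
  tuple_integral mu (fun i x => (Num.sqrt (t i x * t' i x))%:E).

(* Division of extended reals is such that 0 / 0 = 0 and a / 0 = +oo for a > 0;
   moreover 1 / +oo = 0. *)
Definition tuple_ratio (t t' : Tup) (i : 'I_k) (x : X i) : \bar R :=
  ((t i x)%:E / (t' i x)%:E)%E.

Definition rho (r : Tup) (nu : forall i, set (X i) -> \bar R) (t : Tup) : \bar R :=
  ((2^-1)%:E *
   (affinity t r + tuple_integral nu (fun i x => sqrte (tuple_ratio t r x))))%E.

Definition psi (t t' : Tup) (i : 'I_k) (x : X i) : \bar R :=
  ((Num.sqrt 2)^-1%:E *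
   (sqrte (1 / (1 + tuple_ratio t t' x)) - sqrte (1 / (1 + tuple_ratio t' t x))))%E.

Definition Zproc (s : Tup) (nu : forall i, set (X i) -> \bar R) (t t' : Tup) :
    \bar R :=
  (tuple_integral nu (fun i x => psi t t' x)
   - tuple_integral mu (fun i x => psi t t' x * (s i x)%:E))%E.

Definition midpoint (t t' : Tup) : Tup := fun i x => (t i x + t' i x) / 2.

Definition penalized_rho (pen : Tup -> R) (r : Tup)
    (nu : forall i, set (X i) -> \bar R) (t : Tup) : \bar R :=
  (rho r nu t - (2^-1)%:E * tuple_integral mu (fun i x => (t i x)%:E)
   - (pen t)%:E)%E.

Definition Ttest (pen : Tup -> R) (nu : forall i, set (X i) -> \bar R)
    (t t' : Tup) : \bar R :=
  let r := midpoint t t' in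
  (penalized_rho pen r nu t' - penalized_rho pen r nu t)%E.

Section selection.
Context (Lambda : Type) (pen : Tup -> R).

(* In the following two definitions fam is the family of values, at a given
   outcome, of the estimators among which one selects. *)
Definition Eset (nu : forall i, set (X i) -> \bar R) (fam : Lambda -> Tup)
    (t : Tup) : set Tup :=
  [set t' | [/\ range fam t', t' <> t & (0 <= Ttest pen nu t t')%E]].

Definition Dcrit (nu : forall i, set (X i) -> \bar R) (fam : Lambda -> Tup)
    (t : Tup) : \bar R :=
  if Eset nu fam t == set0 then 0%E
  else ereal_sup [set H2 t t' | t' in Eset nu fam t].

Definition Acrit (S : set Tup) (t : Tup) : \bar R :=
  ereal_inf [set (H2 t t' + (pen t')%:E)%E | t' in S].

Definition direct_selection (tau : R) (nu : forall i, set (X i) -> \bar R)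
    (fam : Lambda -> Tup) (l : Lambda) : Prop :=
  forall l', (Dcrit nu fam (fam l) <= Dcrit nu fam (fam l') + tau%:E)%E.

(* shat, stil, ltil, lhat are the values at a given outcome of the initial
   estimators, of their approximations in S, of the index chosen by direct
   selection among the latter, and of the index finally selected. *)
Definition indirect_selection (S : set Tup) (tau : R)
    (nu : forall i, set (X i) -> \bar R) (shat stil : Lambda -> Tup)
    (ltil lhat : Lambda) : Prop :=
  [/\ forall l, S (stil l) /\
        (H2 (shat l) (stil l) + (pen (stil l))%:E
           <= Acrit S (shat l) + tau%:E)%E,
      direct_selection tau nu stil ltil &
      (H2 (shat lhat) (stil ltil)
         <= ereal_inf (range (fun l => H2 (shat l) (stil ltil))) + tau%:E)%E].

End selection.

Section random.
Context (d0 : measure_display) (Omega : measurableType d0).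
Context (P : probability Omega R).
Context (N : forall i, R.-ker Omega ~> X i).

Definition generating_events (i : 'I_k) : set (set Omega) :=
  [set E | exists2 A : set (X i), measurable A &
           exists2 B : set (\bar R), measurable B &
           E = (fun w => N i w A) @^-1` B].

Definition independent_measures : Prop :=
  forall (J : {set 'I_k}) (E : 'I_k -> set Omega),
    (forall i, i \in J -> <<s generating_events i >> (E i)) ->
    P (\bigcap_(i in [set` J]) E i) = (\prod_(i in J) P (E i))%E.

Definition sigma_N : set (set Omega) :=
  <<s \bigcup_(i in [set: 'I_k]) generating_events i >>.

(* Measurability of an L0-valued function of N refers to the sigma-algebra
   generated by the H-balls of L0.  It is contained in the Borel sigma-algebra
   of (L0, H), so Borel measurability implies the one required here. *)
Definition estimator (L0 : set Tup) (f : Omega -> Tup) : Prop :=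
  (forall w, L0 (f w)) /\
  (forall t y, L0 t -> sigma_N (f @^-1` Hball L0 t y)).

End random.
End intensities.

(* Main.v *)
Require Import Defs.
From HB Require Import structures.
From mathcomp Require Import all_boot all_order all_algebra.
From mathcomp Require Import all_classical all_reals all_analysis.
From mathcomp Require Import measurable_realfun.
From mathcomp Require Import lra ring.
Import Order.TTheory GRing.Theory Num.Theory.
Import numFieldNormedType.Exports.
Local Open Scope classical_set_scope.
Local Open Scope ring_scope.

Set Implicit Arguments.
Unset Strict Implicit.
Unset Printing Implicit Defensive.

(** Write [h t t'] for the squared Hellinger loss and [r] for the midpoint of [t]
    and [t'].  Expanding [(sqrt s - sqrt r) ^+ 2] shows that the test statistic is
    [Z(N, t, t') + pen t - pen t'] plus a deterministic part, and convexity of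
    [h s] bounds that part by [(1 + 1/sqrt 2) h s t - (1 - 1/sqrt 2) h s t']
    ([contrast_le], [Ttest_ge0_le]).  So if [t'] beats [t] and if moreover, for
    all pairs of points of [S],
      [Z(N, t, t') <= z (h s t + h s t') + pen t + pen t' + z tau (xi + 1)],
    then [pen t'] cancels and, as [z < 1 - 1/sqrt 2], [h s t'] is at most a
    constant times [h s t + pen t + tau xi] ([preferred_is_close]).

    For two approximations one beats the other, hence the one selected is within
    the same kind of distance of every [stil l] ([selected_is_close]); triangle
    inequalities bring in [shat l] and the estimator finally selected.  The
    tolerances [tau] are absorbed by the penalty, which is at least [2 z tau]
    because [4 eta^2 >= 1] and [Delta >= 1] ([selected_estimator_risk]).

    The uniform bound on [Z] fails with small probability by a union bound over
    pairs of models and over shells ([bad_event_prob]).  Fix two models and put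
    [u = 4 eta^2 + 4 eta'^2 + Delta + Delta' + xi + j].  The ball of squared radius
    [tau u] around [s] contains at most [M^2 exp u] pairs of points of the two
    models, and by the choice of [tau] each pair satisfies [Z > z tau u] with
    probability at most [b exp (- 4 u)].  The remaining factor [exp (- 3 u)] is
    summable over [j] and over the models, with total at most
    [b M^2 Sigma^2 exp (- xi)].  The total masses of the random measures are almost
    surely finite because their means are, so all the integrals above are finite
    outside a null event.

    The risk bound in expectation follows from the deviation bound at the
    integers ([expectation_le_of_tails]).  Measurability of the events involved
    comes from countability of the models, each of which is a countable union of
    finite sets ([local_models_countable]). *)

(** * Finite integrals of tuples *)

Section tuple_integrals.
Context (R : realType) (k : nat) (d : 'I_k -> measure_display).
Context (X : forall i, measurableType (d i)).
Local Notation Tup := (tuple_fun R X).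

Section one_measure.
Context (nu : forall i, {measure set (X i) -> \bar R}).

Definition tuple_integrable (f : Tup) : Prop :=
  forall i, (nu i).-integrable setT (EFin \o f i).

Definition tuple_Rintegral (f : Tup) : R := \sum_(i < k) \int[nu i]_x f i x.

Lemma tuple_integral_EFin (f : Tup) : tuple_integrable f ->
  tuple_integral nu (fun i x => (f i x)%:E) = (tuple_Rintegral f)%:E.
Proof.
move=> intf; rewrite /tuple_integral /tuple_Rintegral -sumEFin.
apply: eq_bigr => i _; rewrite /Rintegral fineK//.
exact: integrable_fin_num.
Qed.

Lemma tuple_integrableD (f g : Tup) : tuple_integrable f ->
  tuple_integrable g -> tuple_integrable (fun i x => f i x + g i x).
Proof.
move=> intf intg i.
by apply: (eq_integrable _ _ _ _ (integrableD measurableT (intf i) (intg i))).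
Qed.

Lemma tuple_integrableZ (a : R) (f : Tup) : tuple_integrable f ->
  tuple_integrable (fun i x => a * f i x).
Proof.
move=> intf i.
by apply: (eq_integrable _ _ _ _ (integrableZl measurableT a (intf i))).
Qed.

Lemma tuple_integrableB (f g : Tup) : tuple_integrable f ->
  tuple_integrable g -> tuple_integrable (fun i x => f i x - g i x).
Proof.
move=> intf intg i.
by apply: (eq_integrable _ _ _ _ (integrableB measurableT (intf i) (intg i))).
Qed.

Lemma le_tuple_integrable (f g : Tup) :
  (forall i, measurable_fun setT (f i)) -> (forall i x, `|f i x| <= g i x) ->
  tuple_integrable g -> tuple_integrable f.
Proof.
move=> mf fg intg i; apply: (le_integrable measurableT _ _ (intg i)).
  exact/measurable_EFinP.
by move=> x _ /=; rewrite lee_fin (le_trans (fg i x))// ler_norm.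
Qed.

Lemma tuple_RintegralD (f g : Tup) : tuple_integrable f ->
  tuple_integrable g -> tuple_Rintegral (fun i x => f i x + g i x) =
                        tuple_Rintegral f + tuple_Rintegral g.
Proof.
move=> intf intg; rewrite /tuple_Rintegral -big_split/=.
by apply: eq_bigr => i _; exact: RintegralD.
Qed.

Lemma tuple_RintegralB (f g : Tup) : tuple_integrable f ->
  tuple_integrable g -> tuple_Rintegral (fun i x => f i x - g i x) =
                        tuple_Rintegral f - tuple_Rintegral g.
Proof.
move=> intf intg; rewrite /tuple_Rintegral -sumrB/=.
by apply: eq_bigr => i _; exact: RintegralB.
Qed.

Lemma tuple_RintegralZ (a : R) (f : Tup) : tuple_integrable f ->
  tuple_Rintegral (fun i x => a * f i x) = a * tuple_Rintegral f.
Proof.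
move=> intf; rewrite /tuple_Rintegral mulr_sumr.
by apply: eq_bigr => i _; exact: RintegralZl.
Qed.

Lemma le_tuple_Rintegral (f g : Tup) : tuple_integrable f ->
  tuple_integrable g -> (forall i x, f i x <= g i x) ->
  tuple_Rintegral f <= tuple_Rintegral g.
Proof.
by move=> intf intg fg; apply: ler_sum => i _; exact: le_Rintegral.
Qed.

Lemma tuple_Rintegral_ge0 (f : Tup) : (forall i x, 0 <= f i x) ->
  0 <= tuple_Rintegral f.
Proof. by move=> f0; apply: sumr_ge0 => i _; exact: Rintegral_ge0. Qed.

(** Bounded measurable tuples are what one integrates against the random
    measure, whose total mass is almost surely finite. *)
Lemma bounded_tuple_integrable (f : Tup) (B : R) :
  (forall i, (nu i setT < +oo)%E) -> (forall i, measurable_fun setT (f i)) ->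
  (forall i x, `|f i x| <= B) -> tuple_integrable f.
Proof.
move=> nufin mf fB i; apply: measurable_bounded_integrable => //.
exists B; split; first exact: num_real.
by move=> y By x _ /=; rewrite (le_trans (fB i x))// ltW.
Qed.

End one_measure.
End tuple_integrals.

(** * Hellinger loss and normalized differences of intensities *)

Section pointwise.
Context (R : realType).
Implicit Types t r s : R.

Lemma measurable_sqrt : measurable_fun setT (@Num.sqrt R).
Proof. by apply: continuous_measurable_fun; exact: sqrt_continuous. Qed.

Lemma measurable_funV d0 (T : measurableType d0) (f : T -> R) :
  (forall x, 0 <= f x) -> measurable_fun setT f ->
  measurable_fun setT (fun x => (f x)^-1).
Proof.
move=> f0 mf; under eq_fun do rewrite -powR_inv1//.
exact: (measurableT_comp (measurable_powR _)).
Qed.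

(** Square root of the ratio [t / r] at a point; in the real field inversion
    sends [0] to [0], which is the convention [0 / 0 = 0] as long as [t]
    vanishes wherever [r] does. *)
Definition sqrt_ratio t r : R := Num.sqrt t / Num.sqrt r.

Definition avg t t' : R := (t + t') / 2.

Definition psi_real t t' : R :=
  2^-1 * (sqrt_ratio t' (avg t t') - sqrt_ratio t (avg t t')).

Lemma avg_ge0 t t' : 0 <= t -> 0 <= t' -> 0 <= avg t t'.
Proof. by move=> *; rewrite divr_ge0// addr_ge0. Qed.

Lemma avgC t t' : avg t t' = avg t' t.
Proof. by rewrite /avg addrC. Qed.

Lemma sqrte_ratio_avg t t' : 0 <= t -> 0 <= t' ->
  sqrte (t%:E / (avg t t')%:E)%E = (sqrt_ratio t (avg t t'))%:E.
Proof.
move=> t0 t'0; rewrite /sqrt_ratio inver; case: eqP => [r0|/eqP rn0].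
  have -> : t = 0 by apply/eqP; rewrite eq_le t0 andbT; move: r0; rewrite /avg; lra.
  by rewrite mul0e sqrte0 sqrtr0 mul0r.
by rewrite -EFinM /= sqrtrM// sqrtrV// avg_ge0.
Qed.

Lemma sqrt_ratio_ge0 t r : 0 <= sqrt_ratio t r.
Proof. by rewrite divr_ge0// sqrtr_ge0. Qed.

Lemma sqrt_ratio_avg_le t t' : 0 <= t -> 0 <= t' ->
  sqrt_ratio t (avg t t') <= Num.sqrt 2.
Proof.
move=> t0 t'0; rewrite /sqrt_ratio.
have [r0|r0] := eqVneq (avg t t') 0.
  by rewrite r0 sqrtr0 invr0 mulr0 sqrtr_ge0.
have rpos : 0 < avg t t' by rewrite lt_neqAle eq_sym r0 avg_ge0.
rewrite ler_pdivrMr ?sqrtr_gt0// -sqrtrM// ler_sqrt ?mulr_ge0 ?avg_ge0//.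
  by rewrite /avg; lra.
by rewrite addr_ge0.
Qed.

Lemma psi_real_bound t t' : 0 <= t -> 0 <= t' -> `|psi_real t t'| <= 1.
Proof.
move=> t0 t'0; rewrite /psi_real.
have h1 := sqrt_ratio_ge0 t (avg t t').
have h2 := sqrt_ratio_ge0 t' (avg t t').
have h3 := sqrt_ratio_avg_le t0 t'0.
have := sqrt_ratio_avg_le t'0 t0; rewrite avgC => h4.
have h5 : Num.sqrt 2 <= 2 :> R.
  rewrite -[leRHS]ger0_norm// -sqrtr_sqr ler_sqrt//; lra.
by rewrite ler_norml; apply/andP; split; lra.
Qed.


Lemma psi_realE t t' : 0 <= t -> 0 <= t' ->
  ((Num.sqrt 2)^-1%:E *
   (sqrte (1 / (1 + t%:E / t'%:E)) - sqrte (1 / (1 + t'%:E / t%:E))) =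
   (psi_real t t')%:E)%E.
Proof.
have key (a b : R) : 0 <= a -> 0 <= b -> 0 < a + b ->
    (sqrte (1 / (1 + a%:E / b%:E)) = (Num.sqrt (b / (a + b)))%:E)%E.
  move=> a0 b0 ab; rewrite div1e inver; case: eqP => [b0'|/eqP bn0].
    have an0 : 0 < a by lra.
    by rewrite gt0_muley ?lte_fin// addey// invey sqrte0 b0' mul0r sqrtr0.
  have bpos : 0 < b by rewrite lt_neqAle eq_sym bn0.
  rewrite -EFinM -EFinD inver; case: eqP => [h|_] /=.
    by exfalso; have := divr_ge0 a0 b0; lra.
  by congr (Num.sqrt _)%:E; field; lra.
move=> t0 t'0; have [tt|tt] := ltP 0 (t + t').
  rewrite !key//; last by rewrite addrC.
  rewrite -EFinB -EFinM; congr EFin.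
  rewrite /psi_real /sqrt_ratio /avg (addrC t' t).
  rewrite !sqrtrM//; last by rewrite ltW.
  rewrite !sqrtrV// ?ltW//.
  have s2 : Num.sqrt 2 != 0 :> R by rewrite sqrtr_eq0 -ltNge.
  have st : Num.sqrt (t + t') != 0 by rewrite sqrtr_eq0 -ltNge.
  have : Num.sqrt 2 ^+ 2 = 2 :> R by rewrite sqr_sqrtr.
  move: s2; set a := Num.sqrt 2 => s2 ha; rewrite -ha; field.
  by rewrite s2 st.
have -> : t = 0 by lra.
have -> : t' = 0 by lra.
by rewrite subee ?mule0 /psi_real ?subrr ?mulr0//= mul0e adde0 div1e inve1.
Qed.

(** With [g = sqrt t] and so on, [2 * psi_real t t'] is [(g' - g) / h], where
    [h ^+ 2 = r = avg t t'].  Expanding shows that the left-hand side is the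
    difference of the Hellinger integrands at [t] and [t'] plus
    [psi_real t t' * (sqrt s - h) ^+ 2]; then [g' <= sqrt 2 * h], and
    [(sqrt s - sqrt _) ^+ 2] is convex. *)
Lemma contrast_le s t t' : 0 <= s -> 0 <= t -> 0 <= t' ->
  2^-1 * (Num.sqrt (t' * avg t t') - Num.sqrt (t * avg t t'))
    - 2^-1 * (t' - t) + psi_real t t' * s
  <= (1 + (Num.sqrt 2)^-1) * (2^-1 * (Num.sqrt s - Num.sqrt t) ^+ 2)
     - (1 - (Num.sqrt 2)^-1) * (2^-1 * (Num.sqrt s - Num.sqrt t') ^+ 2).
Proof.
move=> s0 t0 t'0.
have r0 := avg_ge0 t0 t'0.
rewrite /psi_real /sqrt_ratio (sqrtrM _ t0) (sqrtrM _ t'0).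
have hs := sqr_sqrtr s0; have ht := sqr_sqrtr t0; have ht' := sqr_sqrtr t'0.
have hr := sqr_sqrtr r0.
have ps := sqrtr_ge0 s; have pt := sqrtr_ge0 t; have pt' := sqrtr_ge0 t'.
have pr := sqrtr_ge0 (avg t t').
have c2 : Num.sqrt 2 ^+ 2 = 2 :> R by rewrite sqr_sqrtr.
have c0 : 0 < Num.sqrt 2 :> R by rewrite sqrtr_gt0.
have ravg : avg t t' = (t + t') / 2 by [].
move: ps pt pt' pr c2 c0.
move: hs ht ht' hr; rewrite ravg.
set x := Num.sqrt s; set u := Num.sqrt t; set v := Num.sqrt t'.
set h := Num.sqrt ((t + t') / 2); set c := Num.sqrt 2.
clearbody x u v h c => hs ht ht' hr.
rewrite -hs -ht -ht' in hr * => ps pt pt' pr c2 c0.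
have ci : c^-1 = c / 2 by field: c2; lra.
have [h0|hn0] := eqVneq h 0.
  have u0 : u = 0 by nra.
  have v0 : v = 0 by nra.
  rewrite h0 u0 v0 ci; nra.
have hpos : 0 < h by rewrite lt_neqAle eq_sym hn0.
have uvh : u + v <= 2 * h.
  rewrite -(@ler_pXn2r _ 2)// ?nnegrE ?exprMn; try lra.
  by have := sqr_ge0 (u - v); lra.
have vch : v <= c * h.
  rewrite -(@ler_pXn2r _ 2)// ?nnegrE ?exprMn ?c2; last by rewrite mulr_ge0 ?ltW.
  by have := sqr_ge0 u; lra.
have main : (v - u) / h * (x - h) ^+ 2 <= c * (x - h) ^+ 2.
  rewrite ler_wpM2r ?sqr_ge0// ler_pdivrMr//; nra.
have cvx : (x - h) ^+ 2 <= 2^-1 * ((x - u) ^+ 2 + (x - v) ^+ 2) by nra.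
have expand : (v - u) / h * (x - h) ^+ 2 =
    (v / h - u / h) * x ^+ 2 + (v - u) * h - 2 * x * (v - u) by field.
rewrite ci; nra.
Qed.

End pointwise.

Section hellinger.
Context (R : realType) (k : nat) (d : 'I_k -> measure_display).
Context (X : forall i, measurableType (d i)).
Context (mu : forall i, {measure set (X i) -> \bar R}).
Local Notation Tup := (tuple_fun R X).

Lemma intensities_ge0 (t : Tup) i x : intensities mu t -> 0 <= t i x.
Proof. by move=> /(_ i)[_ + _]; exact. Qed.

Lemma intensities_measurable (t : Tup) i : intensities mu t ->
  measurable_fun setT (t i).
Proof. by move=> /(_ i)[]. Qed.

Lemma intensities_integrable (t : Tup) : intensities mu t ->
  tuple_integrable mu t.
Proof. by move=> tI i; have [] := tI i. Qed.

Lemma midpointC (t t' : Tup) : midpoint t' t = midpoint t t'.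
Proof. by apply: functional_extensionality_dep => i; apply/funext => x; rewrite /midpoint addrC. Qed.

Lemma intensities_midpoint (t t' : Tup) :
  intensities mu t -> intensities mu t' -> intensities mu (midpoint t t').
Proof.
move=> tI t'I i; split.
- apply: measurable_funM => //; apply: measurable_funD.
    exact: (intensities_measurable tI).
  exact: (intensities_measurable t'I).
- move=> x; rewrite /midpoint divr_ge0// addr_ge0//.
    exact: intensities_ge0 tI.
  exact: intensities_ge0 t'I.
- have := tuple_integrableZ 2^-1 (tuple_integrableD
    (intensities_integrable tI) (intensities_integrable t'I)).
  move=> /(_ i); apply: eq_integrable => // x _ /=.
  by rewrite /midpoint mulrC.
Qed.

Definition hellinger_fun (t t' : Tup) : Tup :=
  fun i x => 2^-1 * (Num.sqrt (t i x) - Num.sqrt (t' i x)) ^+ 2.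

Definition hellinger (t t' : Tup) : R :=
  tuple_Rintegral mu (hellinger_fun t t').

Lemma measurable_sqrt_tuple (t : Tup) i : measurable_fun setT (t i) ->
  measurable_fun setT (fun x => Num.sqrt (t i x)).
Proof. by move=> mt; exact: measurableT_comp (@measurable_sqrt R) mt. Qed.

Lemma hellinger_fun_integrable (t t' : Tup) :
  intensities mu t -> intensities mu t' ->
  tuple_integrable mu (hellinger_fun t t').
Proof.
move=> tI t'I; apply: (@le_tuple_integrable _ _ _ _ _ _ (fun i x => t i x + t' i x)).
- move=> i; apply: measurable_funM => //; apply: measurable_funX.
  by apply: measurable_funB; apply: measurable_sqrt_tuple;
    [have [] := tI i | have [] := t'I i].
- move=> i x; rewrite ger0_norm; last by rewrite mulr_ge0 ?sqr_ge0.
  have t0 := intensities_ge0 x tI; have t'0 := intensities_ge0 x t'I.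
  rewrite /hellinger_fun -{2}(sqr_sqrtr t0) -{2}(sqr_sqrtr t'0).
  have := sqrtr_ge0 (t i x); have := sqrtr_ge0 (t' i x); nra.
- exact: tuple_integrableD (intensities_integrable tI) (intensities_integrable t'I).
Qed.

Lemma H2E (t t' : Tup) : intensities mu t -> intensities mu t' ->
  H2 mu t t' = (hellinger t t')%:E.
Proof.
move=> tI t'I; have intH := hellinger_fun_integrable tI t'I.
have intH2 := tuple_integrableZ 2 intH.
have -> : H2 mu t t' = (2^-1%:E * tuple_integral mu
    (fun i x => (2 * hellinger_fun t t' x)%:E))%E.
  rewrite /H2 /hellinger_fun; congr (_ * tuple_integral _ _)%E.
  apply: functional_extensionality_dep => i; apply/funext => x.
  by rewrite mulrA divff// mul1r.
rewrite tuple_integral_EFin// -EFinM tuple_RintegralZ//.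
by rewrite mulrA mulVf// mul1r.
Qed.

Lemma hellinger_ge0 (t t' : Tup) : 0 <= hellinger t t'.
Proof.
by apply: tuple_Rintegral_ge0 => i x; rewrite mulr_ge0 ?sqr_ge0.
Qed.

Lemma hellingerC (t t' : Tup) : hellinger t t' = hellinger t' t.
Proof.
congr tuple_Rintegral; apply: functional_extensionality_dep => i.
by apply/funext => x; rewrite /hellinger_fun -sqrrN opprB.
Qed.

Lemma hellingerxx (t : Tup) : hellinger t t = 0.
Proof.
rewrite /hellinger /tuple_Rintegral big1// => i _.
rewrite -[RHS](mul0r (fine (mu i setT))) -Rintegral_cst//.
by apply: eq_Rintegral => x _; rewrite /hellinger_fun subrr expr0n mulr0.
Qed.

Lemma hellinger_triangle (t u v : Tup) : intensities mu t ->
  intensities mu u -> intensities mu v ->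
  hellinger t v <= 2 * hellinger t u + 2 * hellinger u v.
Proof.
move=> tI uI vI.
have i1 := hellinger_fun_integrable tI uI.
have i2 := hellinger_fun_integrable uI vI.
rewrite /hellinger -!tuple_RintegralZ// -tuple_RintegralD;
  [|exact: tuple_integrableZ..].
apply: le_tuple_Rintegral; first exact: hellinger_fun_integrable.
  by apply: tuple_integrableD; exact: tuple_integrableZ.
move=> i x; rewrite /hellinger_fun.
set a := Num.sqrt _; set b := Num.sqrt _; set c := Num.sqrt _.
by have := sqr_ge0 (a - c - (c - b)); nra.
Qed.

(** * The test statistic is controlled by the centred process *)

Definition psi_tuple (t t' : Tup) : Tup := fun i x => psi_real (t i x) (t' i x).

Lemma psiE (t t' : Tup) i (x : X i) : intensities mu t -> intensities mu t' ->
  psi t t' x = (psi_tuple t t' x)%:E.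
Proof.
move=> tI t'I; rewrite /psi /tuple_ratio psi_realE//.
  exact: intensities_ge0 tI.
exact: intensities_ge0 t'I.
Qed.

Lemma measurable_sqrt_ratio (t t' : Tup) i :
  intensities mu t -> intensities mu t' ->
  measurable_fun setT (fun x => sqrt_ratio (t i x) (avg (t i x) (t' i x))).
Proof.
move=> tI t'I; have mI := intensities_midpoint tI t'I.
apply: measurable_funM.
  exact: measurable_sqrt_tuple (intensities_measurable tI).
apply: measurable_funV; first by move=> x; exact: sqrtr_ge0.
exact: measurable_sqrt_tuple (intensities_measurable mI).
Qed.

Lemma measurable_psi_tuple (t t' : Tup) i :
  intensities mu t -> intensities mu t' ->
  measurable_fun setT (psi_tuple t t' (i:=i)).
Proof.
move=> tI t'I; apply: measurable_funM => //; apply: measurable_funB.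
  under eq_fun do rewrite avgC.
  exact: measurable_sqrt_ratio.
exact: measurable_sqrt_ratio.
Qed.

Lemma psi_tuple_bound (t t' : Tup) i (x : X i) :
  intensities mu t -> intensities mu t' -> `|psi_tuple t t' x| <= 1.
Proof.
move=> tI t'I; apply: psi_real_bound.
  exact: intensities_ge0 tI.
exact: intensities_ge0 t'I.
Qed.

Lemma psi_times_integrable (s t t' : Tup) :
  intensities mu s -> intensities mu t -> intensities mu t' ->
  tuple_integrable mu (fun i x => psi_tuple t t' x * s i x).
Proof.
move=> sI tI t'I; apply: (@le_tuple_integrable _ _ _ _ _ _ s).
- move=> i; apply: measurable_funM; first exact: measurable_psi_tuple.
  exact: intensities_measurable.
- move=> i x; have s0 := intensities_ge0 x sI.
  by rewrite normrM (ger0_norm s0) ler_piMl// psi_tuple_bound.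
- exact: intensities_integrable.
Qed.

Lemma sqrt_mid_integrable (t t' : Tup) :
  intensities mu t -> intensities mu t' ->
  tuple_integrable mu (fun i x => Num.sqrt (t i x * midpoint t t' x)).
Proof.
move=> tI t'I; have mI := intensities_midpoint tI t'I.
apply: (@le_tuple_integrable _ _ _ _ _ _ (fun i x => t i x + midpoint t t' x)).
- move=> i; apply: (measurable_sqrt_tuple (t := fun i x => t i x * midpoint t t' x)).
  by apply: measurable_funM; exact: intensities_measurable.
- move=> i x; rewrite ger0_norm ?sqrtr_ge0//.
  have t0 := intensities_ge0 x tI; have m0 := intensities_ge0 x mI.
  rewrite sqrtrM// -{2}(sqr_sqrtr t0) -{2}(sqr_sqrtr m0).
  have := sqrtr_ge0 (t i x); have := sqrtr_ge0 (midpoint t t' x); nra.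
- exact: tuple_integrableD (intensities_integrable tI) (intensities_integrable mI).
Qed.

Section fixed_measures.
Context (nu : forall i, {measure set (X i) -> \bar R}).
Hypothesis nu_fin : forall i, (nu i setT < +oo)%E.

Lemma psi_integrable (t t' : Tup) : intensities mu t -> intensities mu t' ->
  tuple_integrable nu (psi_tuple t t').
Proof.
move=> tI t'I; apply: (bounded_tuple_integrable (B := 1)) => //.
  by move=> i; exact: measurable_psi_tuple.
by move=> i x; exact: psi_tuple_bound.
Qed.

Lemma sqrt_ratio_integrable (t t' : Tup) :
  intensities mu t -> intensities mu t' ->
  tuple_integrable nu (fun i x => sqrt_ratio (t i x) (midpoint t t' x)).
Proof.
move=> tI t'I; apply: (bounded_tuple_integrable (B := Num.sqrt 2)) => //.
  by move=> i; exact: measurable_sqrt_ratio.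
move=> i x; rewrite ger0_norm ?sqrt_ratio_ge0//.
apply: sqrt_ratio_avg_le; first exact: intensities_ge0 tI.
exact: intensities_ge0 t'I.
Qed.

Definition Z_real (s t t' : Tup) : R :=
  tuple_Rintegral nu (psi_tuple t t')
  - tuple_Rintegral mu (fun i x => psi_tuple t t' x * s i x).

Lemma ZprocE (s t t' : Tup) :
  intensities mu s -> intensities mu t -> intensities mu t' ->
  Zproc mu s nu t t' = (Z_real s t t')%:E.
Proof.
move=> sI tI t'I; rewrite /Zproc /Z_real EFinB.
rewrite -(tuple_integral_EFin (psi_integrable tI t'I)).
rewrite -(tuple_integral_EFin (psi_times_integrable sI tI t'I)).
by congr (_ - _)%E; congr tuple_integral;
  apply: functional_extensionality_dep => i; apply/funext => x;
  rewrite (psiE _ tI t'I).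
Qed.

Variable pen : Tup -> R.

Definition penalized_rho_real (r t : Tup) : R :=
  2^-1 * (tuple_Rintegral mu (fun i x => Num.sqrt (t i x * r i x))
          + tuple_Rintegral nu (fun i x => sqrt_ratio (t i x) (r i x)))
  - 2^-1 * tuple_Rintegral mu t - pen t.

Lemma penalized_rhoE (t t' : Tup) :
  intensities mu t -> intensities mu t' ->
  penalized_rho mu pen (midpoint t t') nu t =
  (penalized_rho_real (midpoint t t') t)%:E.
Proof.
move=> tI t'I; rewrite /penalized_rho /rho /affinity.
rewrite (tuple_integral_EFin (sqrt_mid_integrable tI t'I)).
rewrite (tuple_integral_EFin (intensities_integrable tI)).
have -> : tuple_integral nu
    (fun i x => sqrte (tuple_ratio t (midpoint t t') x)) =
    (tuple_Rintegral nu
       (fun i x => sqrt_ratio (t i x) (midpoint t t' x)))%:E.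
  rewrite -tuple_integral_EFin; last exact: sqrt_ratio_integrable.
  congr tuple_integral; apply: functional_extensionality_dep => i.
  apply/funext => x; apply: sqrte_ratio_avg; first exact: intensities_ge0 tI.
  exact: intensities_ge0 t'I.
by [].
Qed.

Lemma TtestE (t t' : Tup) : intensities mu t -> intensities mu t' ->
  Ttest mu pen nu t t' = (penalized_rho_real (midpoint t t') t'
                          - penalized_rho_real (midpoint t t') t)%:E.
Proof.
move=> tI t'I; rewrite /Ttest /= penalized_rhoE//.
by rewrite -{1}midpointC penalized_rhoE// midpointC.
Qed.

(** The midpoint being symmetric, the test statistic is antisymmetric. *)
Lemma Ttest_total (t t' : Tup) : intensities mu t -> intensities mu t' ->
  (0 <= Ttest mu pen nu t t')%E \/ (0 <= Ttest mu pen nu t' t)%E.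
Proof.
move=> tI t'I; rewrite !TtestE// (midpointC t t') !lee_fin.
by case: (leP (penalized_rho_real (midpoint t t') t)
  (penalized_rho_real (midpoint t t') t')) => h; [left|right]; lra.
Qed.

(** The test statistic splits into the centred process and a deterministic
    part, the latter being at most the integral of the right-hand side of
    [contrast_le]. *)
Lemma Ttest_ge0_le (s t t' : Tup) :
  intensities mu s -> intensities mu t -> intensities mu t' ->
  (0 <= Ttest mu pen nu t t')%E ->
  (1 - (Num.sqrt 2)^-1) * hellinger s t' + pen t' <=
  Z_real s t t' + (1 + (Num.sqrt 2)^-1) * hellinger s t + pen t.
Proof.
move=> sI tI t'I; rewrite TtestE// lee_fin.
have im := sqrt_mid_integrable tI t'I.
have im' := sqrt_mid_integrable t'I tI.
have iq := sqrt_ratio_integrable tI t'I.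
have iq' := sqrt_ratio_integrable t'I tI.
rewrite midpointC in im' iq'.
have it := intensities_integrable tI; have it' := intensities_integrable t'I.
have ip := psi_times_integrable sI tI t'I.
have ih := hellinger_fun_integrable sI tI.
have ih' := hellinger_fun_integrable sI t'I.
have split_psi : tuple_Rintegral nu (psi_tuple t t') =
    2^-1 * (tuple_Rintegral nu (fun i x => sqrt_ratio (t' i x) (midpoint t t' x))
    - tuple_Rintegral nu (fun i x => sqrt_ratio (t i x) (midpoint t t' x))).
  by rewrite -tuple_RintegralB// -tuple_RintegralZ//; exact: tuple_integrableB.
have key : 2^-1 *
      (tuple_Rintegral mu (fun i x => Num.sqrt (t' i x * midpoint t t' x))
       - tuple_Rintegral mu (fun i x => Num.sqrt (t i x * midpoint t t' x)))
    - 2^-1 * (tuple_Rintegral mu t' - tuple_Rintegral mu t)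
    + tuple_Rintegral mu (fun i x => psi_tuple t t' x * s i x)
    <= (1 + (Num.sqrt 2)^-1) * hellinger s t
       - (1 - (Num.sqrt 2)^-1) * hellinger s t'.
  have i1 := tuple_integrableZ 2^-1 (tuple_integrableB im' im).
  have i2 := tuple_integrableZ 2^-1 (tuple_integrableB it' it).
  have i3 := tuple_integrableB i1 i2.
  rewrite /hellinger -(tuple_RintegralB im' im) -(tuple_RintegralB it' it).
  rewrite -(tuple_RintegralZ _ (tuple_integrableB im' im)).
  rewrite -(tuple_RintegralZ _ (tuple_integrableB it' it)).
  rewrite -(tuple_RintegralB i1 i2) -(tuple_RintegralD i3 ip).
  rewrite -(tuple_RintegralZ _ ih) -(tuple_RintegralZ _ ih').
  have j := tuple_integrableZ (1 + (Num.sqrt 2)^-1) ih.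
  have j' := tuple_integrableZ (1 - (Num.sqrt 2)^-1) ih'.
  rewrite -(tuple_RintegralB j j'); apply: le_tuple_Rintegral.
  - exact: tuple_integrableD.
  - exact: tuple_integrableB.
  - move=> i x; apply: contrast_le.
    + exact: intensities_ge0 sI.
    + exact: intensities_ge0 tI.
    + exact: intensities_ge0 t'I.
rewrite /penalized_rho_real /Z_real split_psi; move: key; lra.
Qed.

End fixed_measures.
End hellinger.

(** * Countable unions and infima *)

Section measure_tools.
Context d0 (Omega : measurableType d0) (R : realType).

Lemma countable_bigcup_measurable (I : Type) (D : set I) (F : I -> set Omega) :
  countable D -> (forall i, D i -> measurable (F i)) ->
  measurable (\bigcup_(i in D) F i).
Proof.
move=> /pfcard_geP[->|/unsquash f] mF; first by rewrite bigcup_set0.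
rewrite (_ : \bigcup_(i in D) F i = \bigcup_n F (f n)).
  by apply: bigcupT_measurable => n; apply: mF; exact: funS.
apply/seteqP; split=> [w [i Di Fw]|w [n _ Fw]].
  have [n _ fn] := 'surj_f Di.
  by exists n; rewrite ?fn.
by exists (f n) => //; exact: funS.
Qed.

Lemma measurable_fun_ereal_inf (I : Type) (D : set I) (f : I -> Omega -> \bar R) :
  countable D -> (forall i, D i -> measurable_fun setT (f i)) ->
  measurable_fun setT (fun w => ereal_inf [set f i w | i in D]).
Proof.
move=> cD mf; apply: (measurability _ (ErealGenInftyO.measurableE R)).
move=> /= _ [_ [r ->]] <-.
rewrite (_ : _ `&` _ = \bigcup_(i in D) (setT `&` [set w | (f i w < r%:E)%E])).
  apply: countable_bigcup_measurable => // i Di.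
  exact: emeasurable_fun_infty_o (mf i Di) _.
rewrite setTI; apply/seteqP; split=> w /=; rewrite in_itv/=.
  by move=> /ereal_inf_lt[_ [i Di <-] fr]; exists i => //; split.
move=> [i Di [_ fr]]; apply: le_lt_trans fr.
by apply: ereal_inf_lbound; exists i.
Qed.

Variable P : {measure set Omega -> \bar R}.

Lemma measure_bigcup_le_esum (I : countType) (F : I -> set Omega) :
  (forall i, measurable (F i)) ->
  (P (\bigcup_i F i) <= \esum_(i in [set: I]) P (F i))%E.
Proof.
move=> mF; pose G n := if pickle_inv n is Some i then F i else set0.
have mG n : measurable (G n) by rewrite /G; case: pickle_inv.
have -> : \bigcup_i F i = \bigcup_n G n.
  apply/seteqP; split=> [w [i _ Fw]|w [n _]].
    by exists (pickle i) => //; rewrite /G pickleK_inv.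
  by rewrite /G; case: pickle_inv => // i Fw; exists i.
apply: (le_trans (generalized_Boole_inequality P mG _)).
  exact: bigcupT_measurable.
have -> : (\esum_(i in [set: I]) P (F i) =
    \esum_(n in range (@pickle I)) P (G n))%E.
  rewrite esum_image; last by move=> x y _ _; exact: (pcan_inj pickleK_inv).
  by apply: eq_esum => i _; rewrite /G pickleK_inv.
rewrite nneseries_esumT// [leRHS]esum_mkcond; apply: le_esum => n _.
case: ifPn => // /negP; rewrite inE => nI.
suff -> : G n = set0 by rewrite measure0.
rewrite /G; case e: (pickle_inv n) => [i|]//; exfalso; apply: nI.
by exists i => //; have := @pickle_invK I n; rewrite e.
Qed.

(** The index set is only known up to the bijection with [`I_n], as in the
    counting assumption on the models. *)
Lemma measure_finite_bigcup_le (I : Type) (D : set I) (n : nat)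
    (F : I -> set Omega) (q : R) :
  (D #= `I_n)%card -> (forall i, D i -> measurable (F i)) ->
  (forall i, D i -> (P (F i) <= q%:E)%E) ->
  (P (\bigcup_(i in D) F i) <= (n%:R * q)%:E)%E.
Proof.
elim: n D => [|n IH] D.
  rewrite II0 card_eq0 => /eqP -> _ _.
  by rewrite bigcup_set0 measure0 mul0r.
move=> /eq_cardSP[x Dx cD] mF Fq.
have finD : finite_set (D `\ x) by apply/finite_setP; exists n.
have -> : \bigcup_(i in D) F i = F x `|` \bigcup_(i in D `\ x) F i.
  by rewrite -bigcup_setU1 setD1K.
have mF' i : (D `\ x) i -> measurable (F i) by move=> [Di _]; exact: mF.
apply: le_trans (measureU2 _ _ _) _; first exact: mF.
  exact: fin_bigcup_measurable.
rewrite -nat1r mulrDl mul1r EFinD; apply: leeD; first exact: Fq.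
by apply: IH => // i [Di _]; exact: Fq.
Qed.

End measure_tools.

(** * Measurability of the losses and of the centred process *)

Section random_measures.
Context (R : realType) (k : nat) (d : 'I_k -> measure_display).
Context (X : forall i, measurableType (d i)).
Context (mu : forall i, {measure set (X i) -> \bar R}).
Context d0 (Omega : measurableType d0) (P : probability Omega R).
Context (N : forall i, R.-ker Omega ~> X i).
Local Notation Tup := (tuple_fun R X).

Lemma measurable_integral_kernel d' (Y : measurableType d')
    (K : R.-ker Omega ~> Y) (f : Y -> \bar R) : measurable_fun setT f ->
  measurable_fun setT (fun w => \int[K w]_y f y)%E.
Proof.
move=> mf; under eq_fun do rewrite integralE.
apply: emeasurable_funB; apply: measurable_fun_integral_kernel => //.
- by move=> U mU; exact: measurable_kernel.
- exact: measurable_funepos.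
- by move=> U mU; exact: measurable_kernel.
- exact: measurable_funeneg.
Qed.

Lemma measurable_Zproc (s t t' : Tup) :
  intensities mu t -> intensities mu t' ->
  measurable_fun setT (fun w => Zproc mu s (fun i => N i w) t t').
Proof.
move=> tI t'I; apply: emeasurable_funB => //.
apply: emeasurable_sum => i; apply: measurable_integral_kernel.
apply: (eq_measurable_fun (EFin \o psi_tuple t t' (i := i))).
  by move=> x _; rewrite (psiE _ tI t'I).
by apply/measurable_EFinP; exact: measurable_psi_tuple.
Qed.

Definition infinite_mass : set Omega := \bigcup_i [set w | N i w setT = +oo%E].

Lemma infinite_mass_measurable : measurable infinite_mass.
Proof.
apply: countable_bigcup_measurable => // i _.
rewrite -[X in measurable X]setTI.
have := measurable_kernel (N i) setT measurableT measurableT _ (emeasurable_set1 +oo%E).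
exact.
Qed.

Lemma infinite_mass_null :
  (forall i, (\int[P]_w N i w setT < +oo)%E) -> P infinite_mass = 0%E.
Proof.
move=> hN; apply/eqP; rewrite eq_le measure_ge0 andbT.
have mI i : measurable [set w | N i w setT = +oo%E].
  rewrite -[X in measurable X]setTI.
  have := measurable_kernel (N i) setT measurableT measurableT _ (emeasurable_set1 +oo%E).
  exact.
apply: le_trans (measure_bigcup_le_esum P mI) _.
rewrite esum1// => i _.
apply/negligibleP => //.
have intN : P.-integrable setT (fun w => N i w setT).
  apply/integrableP; split; first exact: measurable_kernel.
  by under eq_integral do rewrite gee0_abs//.
apply: negligibleS (integrable_ae measurableT intN).
by move=> w /= Nw /(_ I); rewrite Nw.
Qed.

Lemma not_infinite_mass w : ~ infinite_mass w ->
  forall i, (N i w setT < +oo)%E.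
Proof.
by move=> nI i; rewrite ltey; apply/eqP => Ni; apply: nI; exists i.
Qed.

Lemma sigma_N_measurable : sigma_N N `<=` measurable.
Proof.
apply: smallest_sub; first exact: sigma_algebra_measurable.
move=> E [i _ [A mA [B mB ->]]].
rewrite -[X in measurable X]setTI.
exact: measurable_kernel.
Qed.

Lemma HballE (L0 : set Tup) (t t' : Tup) (y : R) : 0 <= y ->
  intensities mu t -> intensities mu t' ->
  (Hdist mu t t' <= y%:E)%E = (hellinger mu t t' <= y ^+ 2).
Proof.
move=> y0 tI t'I; rewrite /Hdist H2E//= lee_fin.
rewrite -[in LHS](ger0_norm y0) -sqrtr_sqr ler_sqrt// sqr_ge0//.
Qed.

Variable L0 : set Tup.
Hypothesis L0I : L0 `<=` intensities mu.

(** The balls generating the sigma-algebra of estimators are centred in [L0], so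
    they are the lower level sets of the loss with respect to a point of [L0]. *)
Lemma measurable_H2_estimator (f : Omega -> Tup) (t : Tup) :
  estimator mu N L0 f -> L0 t ->
  measurable_fun setT (fun w => H2 mu t (f w)).
Proof.
move=> [fL fm] tL; apply: (measurability _ (ErealGenOInfty.measurableE R)).
move=> /= _ [_ [r ->]] <-; apply: measurableI => //.
have eqf w : H2 mu t (f w) = (hellinger mu t (f w))%:E.
  by rewrite H2E//; exact: L0I.
have [r0|r0] := ltP r 0.
  rewrite (_ : _ @^-1` _ = setT)//; apply/seteqP; split=> // w _ /=.
  by rewrite in_itv/= andbT eqf lte_fin (lt_le_trans r0)// hellinger_ge0.
rewrite (_ : _ @^-1` _ = ~` (f @^-1` Hball mu L0 t (Num.sqrt r))).
  by apply: measurableC; apply: sigma_N_measurable; exact: fm.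
apply/seteqP; split=> w /=; rewrite in_itv/= andbT eqf lte_fin.
  move=> rh [_]; rewrite HballE ?sqrtr_ge0//; try exact: L0I.
  by rewrite sqr_sqrtr// leNgt rh.
move=> nb; rewrite ltNge; apply/negP => hr; apply: nb; split; first exact: fL.
by rewrite HballE ?sqrtr_ge0 ?sqr_sqrtr//; exact: L0I.
Qed.

Lemma H2C (t t' : Tup) : L0 t -> L0 t' -> H2 mu t t' = H2 mu t' t.
Proof. by move=> /L0I tI /L0I t'I; rewrite !H2E// hellingerC. Qed.

Lemma measurable_Acrit_estimator (f : Omega -> Tup) (S : set Tup)
    (pen : Tup -> R) : estimator mu N L0 f -> S `<=` L0 -> countable S ->
  measurable_fun setT (fun w => Acrit mu pen S (f w)).
Proof.
move=> fE SL cS; apply: measurable_fun_ereal_inf => // t' St'.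
apply: emeasurable_funD => //.
under eq_fun do rewrite (H2C (fE.1 _) (SL _ St')).
by apply: measurable_H2_estimator => //; exact: SL.
Qed.

End random_measures.

(** * Uniform control of the centred process over all pairs of models *)

Lemma esumZl_le (R : realType) (I : choiceType) (D : set I) (c : R)
    (f : I -> \bar R) : 0 <= c -> (forall i, 0 <= f i)%E ->
  (\esum_(i in D) (c%:E * f i) <= c%:E * \esum_(i in D) f i)%E.
Proof.
move=> c0 f0; apply: ge_ereal_sup => _ [A [finA AD] <-].
rewrite -ge0_mule_fsumr//; apply: lee_wpmul2l => //.
by apply: esum_ge; exists A.
Qed.

Lemma expR_opp_nat_le (R : realType) (n : nat) :
  expR (- n%:R) <= ((2 ^ n)%:R)^-1 :> R.
Proof.
rewrite expRN lef_pV2 ?posrE ?expR_gt0 ?ltr0n ?expn_gt0//.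
rewrite natrX -[n%:R]mulr1 expRM_natl lerXn2r ?nnegrE ?expR_ge0//.
by have := expR_ge1Dx (1 : R); lra.
Qed.

Section deviation.
Context (R : realType) (k : nat) (d : 'I_k -> measure_display).
Context (X : forall i, measurableType (d i)).
Context (mu : forall i, {measure set (X i) -> \bar R}).
Context d0 (Omega : measurableType d0) (P : probability Omega R).
Context (N : forall i, R.-ker Omega ~> X i).
Local Notation Tup := (tuple_fun R X).
Context (s : Tup) (L0 : set Tup).
Hypothesis L0I : L0 `<=` intensities mu.
Hypothesis L0s : L0 s.
Context (I : countType) (Sm : I -> set Tup) (eta Delta : I -> R).
Context (M a b c tau z : R).
Hypothesis a_gt0 : 0 < a.
Hypothesis b_ge0 : 0 <= b.
Hypothesis c_ge0 : 0 <= c.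
Hypothesis z_gt0 : 0 < z.
Hypothesis tauE : tau = 4 * (2 + c * z) / (a * z ^+ 2).
Hypothesis dev : forall y xi : R, 0 < y -> 0 < xi ->
  (ereal_sup [set P [set w | xi%:E < Zproc mu s (fun i => N i w) p.1 p.2]
             | p in Hball mu L0 s y `*` Hball mu L0 s y]
   <= (b * expR (- (a * xi ^+ 2 / (y ^+ 2 + c * xi))))%:E)%E.
Hypothesis SmL0 : forall m, Sm m `<=` L0.
Hypothesis eta_ge : forall m, 2^-1 <= eta m.
Hypothesis Delta_ge : forall m, 1 <= Delta m.
Hypothesis card_ball : forall m (r : R), 2 * eta m <= r ->
  exists2 n : nat, (Sm m `&` Hball mu L0 s (r * Num.sqrt tau) #= `I_n)%card &
                   n%:R <= M * expR (r ^+ 2 / 2).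

Lemma tau_gt0 : 0 < tau.
Proof.
rewrite tauE divr_gt0 ?mulr_gt0 ?exprn_gt0// ltr_wpDr// mulr_ge0//.
exact: ltW.
Qed.

Definition local_model (m : I) (u : R) : set Tup :=
  Sm m `&` Hball mu L0 s (Num.sqrt u * Num.sqrt tau).

Definition exceedance (u : R) (t t' : Tup) : set Omega :=
  [set w | ((z * (tau * u))%:E < Zproc mu s (fun i => N i w) t t')%E].

Definition local_exceedance (m m' : I) (u : R) : set Omega :=
  \bigcup_(t in local_model m u) \bigcup_(t' in local_model m' u)
    exceedance u t t'.

Lemma exceedance_measurable u (t t' : Tup) :
  L0 t -> L0 t' -> measurable (exceedance u t t').
Proof.
move=> /L0I tI /L0I t'I; rewrite -[X in measurable X]setTI.
exact: emeasurable_fun_o_infty measurableT (measurable_Zproc N s tI t'I) _.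
Qed.

(** The value of [tau] makes the exponent in the deviation bound at least
    [4 * u]; since the two balls contain at most [M ^+ 2 * expR u] pairs, a
    factor [expR (- 3 * u)] remains. *)
Lemma exceedance_exponent u : 0 < u ->
  4 * u <= a * (z * (tau * u)) ^+ 2 /
     ((Num.sqrt u * Num.sqrt tau) ^+ 2 + c * (z * (tau * u))).
Proof.
move=> u0; have t0 := tau_gt0; rewrite [(Num.sqrt u * _) ^+ 2]exprMn !sqr_sqrtr ?(ltW u0) ?(ltW t0)//.
have cz : 0 <= c * z by rewrite mulr_ge0// ltW.
have -> : a * (z * (tau * u)) ^+ 2 / (u * tau + c * (z * (tau * u))) =
    (a * z ^+ 2 * tau) * u / (1 + c * z).
  have -> : u * tau + c * (z * (tau * u)) = (1 + c * z) * (tau * u) by ring.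
  by field; rewrite !gt_eqF// ltr_wpDr.
have -> : a * z ^+ 2 * tau = 4 * (2 + c * z) by rewrite tauE; field; rewrite !gt_eqF.
by rewrite ler_pdivlMr; nra.
Qed.

Lemma le_sqrt_of_sqr (x u : R) : x ^+ 2 <= u -> x <= Num.sqrt u.
Proof.
move=> xu; rewrite (le_trans (ler_norm x))// -sqrtr_sqr ler_sqrt//.
exact: le_trans (sqr_ge0 x) xu.
Qed.

Lemma local_model_card m u : 4 * eta m ^+ 2 <= u -> exists2 n : nat,
  (local_model m u #= `I_n)%card & n%:R <= M * expR (u / 2).
Proof.
move=> mu_; have u0 : 0 <= u by apply: le_trans mu_; rewrite mulr_ge0 ?sqr_ge0.
have [|n cn nM] := card_ball (m := m) (r := Num.sqrt u).
  by apply: le_sqrt_of_sqr; rewrite exprMn; lra.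
by exists n => //; rewrite sqr_sqrtr in nM.
Qed.

Lemma local_exceedance_measurable m m' u :
  4 * eta m ^+ 2 <= u -> 4 * eta m' ^+ 2 <= u ->
  measurable (local_exceedance m m' u).
Proof.
move=> /local_model_card[n cn _] /local_model_card[n' cn' _].
apply: fin_bigcup_measurable; first by apply/finite_setP; exists n.
move=> t [/SmL0 tL _]; apply: fin_bigcup_measurable.
  by apply/finite_setP; exists n'.
by move=> t' [/SmL0 t'L _]; exact: exceedance_measurable.
Qed.

Lemma local_exceedance_prob m m' u :
  0 < u -> 4 * eta m ^+ 2 <= u -> 4 * eta m' ^+ 2 <= u ->
  (P (local_exceedance m m' u) <= (b * M ^+ 2 * expR (- (3 * u)))%:E)%E.
Proof.
move=> u0 /local_model_card[n cn nM] /local_model_card[n' cn' nM'].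
have finS p q : (local_model p u #= `I_q)%card -> finite_set (local_model p u).
  by move=> cp; apply/finite_setP; exists q.
have exc t t' : local_model m u t -> local_model m' u t' ->
    (P (exceedance u t t') <= (b * expR (- (4 * u)))%:E)%E.
  move=> [_ tB] [_ t'B].
  have y0 : 0 < Num.sqrt u * Num.sqrt tau by rewrite mulr_gt0 ?sqrtr_gt0 ?tau_gt0.
  have x0 : 0 < z * (tau * u) by rewrite !mulr_gt0 ?tau_gt0.
  apply: le_trans (le_trans _ (dev y0 x0)) _.
    by apply: ereal_sup_ubound; exists (t, t').
  by rewrite lee_fin ler_wpM2l// ler_expR lerN2 exceedance_exponent.
apply: (@le_trans _ _ (n%:R * (n'%:R * (b * expR (- (4 * u)))))%:E).
  apply: measure_finite_bigcup_le => // [t [/SmL0 tL _]|t tm].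
    apply: fin_bigcup_measurable; first exact: finS cn'.
    by move=> t' [/SmL0 t'L _]; exact: exceedance_measurable.
  apply: measure_finite_bigcup_le => // [t' [/SmL0 t'L _]|t' t'm].
    by apply: exceedance_measurable => //; case: tm => /SmL0.
  exact: exc.
rewrite lee_fin mulrA; apply: (@le_trans _ _
    ((M * expR (u / 2)) * (M * expR (u / 2)) * (b * expR (- (4 * u))))).
  by rewrite ler_wpM2r ?ler_pM// mulr_ge0 ?expR_ge0.
have -> : - (3 * u) = u / 2 + u / 2 - (4 * u) by field.
by rewrite !expRD le_eqVlt; apply/orP; left; apply/eqP; ring.
Qed.

Definition base_level (xi : R) (m m' : I) : R :=
  (4 * eta m ^+ 2 + Delta m) + (4 * eta m' ^+ 2 + Delta m') + xi.

(** Peeling: the level [base_level + j] serves the pairs of points whose squared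
    distances to [s] are at most [tau * (base_level + j)]. *)
Definition bad_event (xi : R) : set Omega :=
  \bigcup_m \bigcup_m' \bigcup_(j : nat)
    local_exceedance m m' (base_level xi m m' + j%:R).

Lemma base_level_ge xi m m' : 0 < xi ->
  [/\ 1 <= base_level xi m m', 4 * eta m ^+ 2 <= base_level xi m m' &
      4 * eta m' ^+ 2 <= base_level xi m m'].
Proof.
move=> xi0; rewrite /base_level; have := sqr_ge0 (eta m).
have := sqr_ge0 (eta m'); have := Delta_ge m; have := Delta_ge m'.
by split; lra.
Qed.

Lemma level_ge xi m m' (j : nat) : 0 < xi ->
  let u := base_level xi m m' + j%:R in
  [/\ 0 < u, 4 * eta m ^+ 2 <= u & 4 * eta m' ^+ 2 <= u].
Proof.
move=> xi0 u; have [h1 h2 h3] := base_level_ge m m' xi0.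
by have := ler0n R j; rewrite /u; split; lra.
Qed.

Lemma bad_cell_measurable xi m m' (j : nat) : 0 < xi ->
  measurable (local_exceedance m m' (base_level xi m m' + j%:R)).
Proof.
by move=> xi0; have [_ ? ?] := level_ge m m' j xi0; exact: local_exceedance_measurable.
Qed.

Lemma bad_event_measurable xi : 0 < xi -> measurable (bad_event xi).
Proof.
move=> xi0; do 3![apply: countable_bigcup_measurable => // ? _].
exact: bad_cell_measurable.
Qed.

(** As [base_level] is at least [1], three times the level exceeds [base_level] by
    [j.+1] or more: the sum over [j] is then at most [expR (- base_level)], which
    is a product of one factor for each model and of [expR (- xi)]. *)
Lemma bad_event_prob (Sigma xi : R) : 0 < xi ->
  (\esum_(m in [set: I]) (expR (- Delta m))%:E)%E = Sigma%:E ->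
  (P (bad_event xi) <= (b * M ^+ 2 * Sigma ^+ 2 * expR (- xi))%:E)%E.
Proof.
move=> xi0 hSigma; have B0 : 0 <= b * M ^+ 2 by rewrite mulr_ge0 ?sqr_ge0.
have := local_exceedance_prob; set B := b * M ^+ 2 in B0 *.
clearbody B => prob_cell.
have Sigma0 : 0 <= Sigma.
  by rewrite -lee_fin -hSigma; apply: esum_ge0 => m _; rewrite lee_fin expR_ge0.
have sumj m m' : (P (\bigcup_(j : nat)
      local_exceedance m m' (base_level xi m m' + j%:R))
    <= (B * expR (- base_level xi m m'))%:E)%E.
  have [h1 _ _] := base_level_ge m m' xi0.
  have Be : 0 <= B * expR (- base_level xi m m') by rewrite mulr_ge0 ?expR_ge0.
  apply: le_trans (generalized_Boole_inequality P _ _) _.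
  - by move=> j; exact: bad_cell_measurable.
  - by apply: bigcupT_measurable => j; exact: bad_cell_measurable.
  apply: le_trans (epsilon_trick0 xpredT Be).
  apply: lee_nneseries => // j _.
  have [u0 um um'] := level_ge m m' j xi0.
  apply: le_trans (prob_cell _ _ _ u0 um um') _.
  rewrite lee_fin -[leRHS]mulrA ler_wpM2l//.
  apply: (@le_trans _ _ (expR (- base_level xi m m' - j.+1%:R))).
    rewrite ler_expR -natr1; have := ler0n R j; lra.
  by rewrite expRD ler_wpM2l ?expR_ge0// expR_opp_nat_le.
have summ' m : (P (\bigcup_m' \bigcup_(j : nat)
      local_exceedance m m' (base_level xi m m' + j%:R))
    <= (B * expR (- xi) * Sigma)%:E * (expR (- Delta m))%:E)%E.
  apply: le_trans (measure_bigcup_le_esum P _) _.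
    by move=> m'; apply: bigcupT_measurable => j; exact: bad_cell_measurable.
  apply: (@le_trans _ _ (\esum_(m' in [set: I])
      ((B * expR (- xi) * expR (- Delta m))%:E * (expR (- Delta m'))%:E))%E).
    apply: le_esum => m' _; apply: le_trans (sumj m m') _.
    rewrite -EFinM lee_fin -!mulrA ler_wpM2l// -!expRD ler_expR /base_level.
    have := sqr_ge0 (eta m); have := sqr_ge0 (eta m'); lra.
  apply: le_trans (esumZl_le _ _ _) _.
  - by rewrite !mulr_ge0 ?expR_ge0.
  - by move=> m'; rewrite lee_fin expR_ge0.
  rewrite hSigma -!EFinM lee_fin le_eqVlt; apply/orP; left; apply/eqP; ring.
apply: le_trans (measure_bigcup_le_esum P _) _.
  move=> m; do 2![apply: countable_bigcup_measurable => // ? _].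
  exact: bad_cell_measurable.
apply: le_trans (le_esum (fun m _ => summ' m)) _.
apply: le_trans (esumZl_le _ _ _) _.
- by rewrite !mulr_ge0 ?expR_ge0.
- by move=> m; rewrite lee_fin expR_ge0.
rewrite hSigma -!EFinM lee_fin le_eqVlt; apply/orP; left; apply/eqP.
by ring.
Qed.

(** With [W] the sum of the two squared distances, the shell is the first integer
    [j] exceeding [W / tau]; rounding up costs the additional [z * tau]. *)
Lemma not_bad_event_le xi w m m' (t t' : Tup) : 0 < xi ->
  (forall i, (N i w setT < +oo)%E) -> ~ bad_event xi w -> Sm m t -> Sm m' t' ->
  Z_real mu (fun i => N i w) s t t' <=
  z * (hellinger mu s t + hellinger mu s t')
  + z * tau * (base_level xi m m' + 1).
Proof.
move=> xi0 Nfin nbad Smt Smt'; rewrite leNgt; apply/negP => Zgt; apply: nbad.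
have tL := SmL0 Smt; have t'L := SmL0 Smt'.
have sI := L0I L0s; have tI := L0I tL; have t'I := L0I t'L.
have h0 := hellinger_ge0 mu s t; have h0' := hellinger_ge0 mu s t'.
have t0 := tau_gt0.
set W := hellinger mu s t + hellinger mu s t' in Zgt.
pose j := (Num.trunc (W / tau)).+1.
have W0 : 0 <= W / tau by rewrite divr_ge0 ?addr_ge0// ltW.
have /andP[jle jgt] := truncn_itv W0.
have [b1 b2 b3] := base_level_ge m m' xi0.
have Wj : W <= tau * j%:R.
  by rewrite mulrC -ler_pdivrMr// ltW.
have jW : tau * j%:R <= W + tau.
  have : tau * (Num.trunc (W / tau))%:R <= W by rewrite mulrC -ler_pdivlMr.
  by rewrite /j -natr1 mulrDr mulr1; lra.
exists m => //; exists m' => //; exists j => //.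
set u := base_level xi m m' + j%:R.
have u0 : 0 <= u by rewrite addr_ge0 ?ler0n//; lra.
have Wu : W <= tau * u by rewrite /u mulrDr; nra.
have inball v : L0 v -> hellinger mu s v <= W ->
    Hball mu L0 s (Num.sqrt u * Num.sqrt tau) v.
  move=> vL hv; split=> //.
  rewrite HballE ?mulr_ge0 ?sqrtr_ge0//; last exact: L0I.
  by rewrite exprMn !sqr_sqrtr// ?(ltW t0)// mulrC (le_trans hv).
exists t; first by split=> //; apply: inball => //; rewrite /W; lra.
exists t'; first by split=> //; apply: inball => //; rewrite /W; lra.
rewrite /exceedance /= ZprocE// lte_fin; apply: le_lt_trans Zgt.
have : z * (tau * j%:R) <= z * (W + tau) by rewrite ler_wpM2l// ltW.
by rewrite /u; lra.
Qed.

(** All squared distances to [s] are finite, hence the balls exhaust a model. *)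
Lemma local_models_countable m : countable (Sm m).
Proof.
have -> : Sm m = \bigcup_(n : nat) local_model m (4 * eta m ^+ 2 + n%:R).
  apply/seteqP; split=> [t Smt|t [n _ []]//].
  have t0 := tau_gt0; have h0 := hellinger_ge0 mu s t.
  have W0 : 0 <= hellinger mu s t / tau by rewrite divr_ge0// ltW.
  have /andP[_ jgt] := truncn_itv W0.
  exists (Num.trunc (hellinger mu s t / tau)).+1 => //; split=> //; split.
    exact: SmL0 Smt.
  have sI := L0I L0s; have tI := L0I (SmL0 Smt).
  rewrite HballE ?mulr_ge0 ?sqrtr_ge0//.
  have u0 : 0 <= 4 * eta m ^+ 2 by rewrite mulr_ge0 ?sqr_ge0.
  rewrite exprMn !sqr_sqrtr ?(ltW t0) ?addr_ge0//.
  by rewrite -ler_pdivrMr// (le_trans (ltW jgt))// lerDr.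
apply: bigcup_countable => // n _; apply: finite_set_countable.
have [|q cq _] := local_model_card (m := m) (u := 4 * eta m ^+ 2 + n%:R).
  by rewrite lerDl.
by apply/finite_setP; exists q.
Qed.

Variables (S : set Tup) (pen : Tup -> R).
Hypothesis SE : S = \bigcup_m Sm m.
Hypothesis pen_ge : forall t, S t ->
  z * tau * inf [set 4 * eta m ^+ 2 + Delta m | m in [set m | Sm m t]] <= pen t.

Let weights (t : Tup) := [set 4 * eta m ^+ 2 + Delta m | m in [set m | Sm m t]].

Let weights_n0 t : S t -> weights t !=set0.
Proof. by rewrite SE => -[m _ Smt]; exists (4 * eta m ^+ 2 + Delta m); exists m. Qed.

Lemma pen_lower t : S t -> 2 * z * tau <= pen t.
Proof.
move=> St; apply: le_trans (pen_ge St).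
have zt : 0 < z * tau by rewrite mulr_gt0 ?tau_gt0.
suff : 2 <= inf (weights t) by rewrite -/(weights t); nra.
apply: lb_le_inf; first exact: weights_n0.
by move=> _ [m _ <-]; have := eta_ge m; have := Delta_ge m; nra.
Qed.

(** The bound of [not_bad_event_le] holds for every pair of models containing
    the two points, hence for the infima defining the penalty. *)
Lemma not_bad_event_pen xi w (t t' : Tup) : 0 < xi ->
  (forall i, (N i w setT < +oo)%E) -> ~ bad_event xi w -> S t -> S t' ->
  Z_real mu (fun i => N i w) s t t' <=
  z * (hellinger mu s t + hellinger mu s t')
  + pen t + pen t' + z * tau * (xi + 1).
Proof.
move=> xi0 Nfin nbad St St'.
have zt : 0 < z * tau by rewrite mulr_gt0 ?tau_gt0.
set Z := Z_real _ _ _ _ _; set h := z * _.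
have step m' : Sm m' t' ->
    (Z - h) / (z * tau) - (4 * eta m' ^+ 2 + Delta m') - (xi + 1) <= inf (weights t).
  move=> Smt'; apply: lb_le_inf; first exact: weights_n0.
  move=> _ [m Smt <-].
  have := not_bad_event_le xi0 Nfin nbad Smt Smt'.
  rewrite -/Z -/h /base_level => ZZ.
  have : (Z - h) / (z * tau) <= base_level xi m m' + 1.
    by rewrite ler_pdivrMr// [_ * (z * tau)]mulrC /base_level; lra.
  by rewrite /base_level; lra.
have : (Z - h) / (z * tau) - inf (weights t) - (xi + 1) <= inf (weights t').
  apply: lb_le_inf; first exact: weights_n0.
  by move=> _ [m' Smt' <-]; have := step m' Smt'; lra.
have pt := pen_ge St; have pt' := pen_ge St'.
rewrite -/(weights t) in pt; rewrite -/(weights t') in pt'.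
move=> key; have : Z - h <= (inf (weights t) + inf (weights t') + (xi + 1)) * (z * tau).
  by rewrite -ler_pdivrMr//; lra.
lra.
Qed.

End deviation.

(** * The selected estimator at a good outcome *)

(** Real arithmetic behind [preferred_is_close]: [f], [f'] and [g] stand for the
    squared distances from [s] to [t], from [s] to [t'] and from [t] to [t'], [p]
    and [p'] for the penalties, [x] for [tau * xi]. *)
Lemma preferred_arith (R : realFieldType) (c z tau x f f' g p p' Z : R) :
  0 < c -> 0 < z -> z < 1 - c -> 0 < z * tau -> 0 <= x -> 0 <= f ->
  2 * z * tau <= p ->
  Z <= z * (f + f') + p + p' + (z * x + z * tau) ->
  (1 - c) * f' + p' <= Z + (1 + c) * f + p ->
  g <= 2 * f + 2 * f' ->
  g <= (2 + 6 / (1 - c - z)) * (f + p + x).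
Proof.
move=> c0 z0 zc zt x0 f0 pz Zle main tri.
have k0 : 0 < 1 - c - z by lra.
have zx : z * x <= x by rewrite ler_piMl//; lra.
have cf : (1 + c + z) * f <= 2 * f by rewrite ler_wpM2r//; lra.
have kf : (1 - c - z) * f' <= 3 * (f + p + x) by lra.
have fQ : f' <= 3 * (f + p + x) / (1 - c - z) by rewrite ler_pdivlMr// mulrC.
have -> : (2 + 6 / (1 - c - z)) * (f + p + x) =
    2 * (f + p + x) + 2 * (3 * (f + p + x) / (1 - c - z)).
  by field; rewrite gt_eqF.
lra.
Qed.

(** Real arithmetic behind [selected_estimator_risk].  With [y] the selected
    approximation, [a], [f], [v] and [V] are the squared distances from [s] to
    [shat l], [stil l], [y] and the final estimator; [e] and [w] those from
    [shat l] to [stil l] and [y]; [g] and [w'] those from [y] to [stil l] and to the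
    final estimator; [p] is the penalty of [stil l] and [x] is [tau * xi].  The
    lower bound [2 * z * tau] on the penalized distance [A] absorbs the
    tolerances [tau]. *)
Lemma risk_arith (R : realFieldType) (K z tau x a A e f g p v w w' V : R) :
  2 <= K -> 0 < z -> 0 < tau -> 0 <= x -> 0 <= a -> 0 <= e ->
  2 * z * tau <= p -> 2 * z * tau <= A -> e + p <= A + tau ->
  g <= K * (f + p + x) + tau ->
  V <= 2 * v + 2 * w' -> w' <= w + tau -> v <= 2 * f + 2 * g ->
  w <= 2 * e + 2 * g -> f <= 2 * a + 2 * e ->
  V <= (22 + 16 * K) * (1 + (2 * z)^-1) * (a + A + x).
Proof.
move=> K2 z0 tau0 x0 a0 e0 pz Az ep gK Vv ww vf we fa.
have zt : 0 < z * tau by rewrite mulr_gt0.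
have KQ : K * (f + p + x) <= K * (2 * a + 2 * (A + tau) + x).
  by rewrite ler_wpM2l//; lra.
have Kx : 0 <= K * x by rewrite mulr_ge0//; lra.
have B2 : V <= (22 + 16 * K) * (a + (A + tau) + x) by lra.
have tauA : A + tau <= (1 + (2 * z)^-1) * A.
  by rewrite mulrDl mul1r lerD2l ler_pdivlMl// mulr_gt0.
apply: le_trans B2 _; rewrite -mulrA ler_wpM2l//; first lra.
have iz : 0 <= (2 * z)^-1 by rewrite invr_ge0 mulr_ge0// ltW.
have iza : 0 <= (2 * z)^-1 * a by rewrite mulr_ge0.
have izx : 0 <= (2 * z)^-1 * x by rewrite mulr_ge0.
by lra.
Qed.

Section selected_estimator.
Context (R : realType) (k : nat) (d : 'I_k -> measure_display).
Context (X : forall i, measurableType (d i)).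
Context (mu nu : forall i, {measure set (X i) -> \bar R}).
Local Notation Tup := (tuple_fun R X).
Local Notation h := (hellinger mu).
Context (s : Tup) (L0 S : set Tup) (pen : Tup -> R).
Context (z tau xi : R).
Hypothesis nu_fin : forall i, (nu i setT < +oo)%E.
Hypothesis L0I : L0 `<=` intensities mu.
Hypothesis L0s : L0 s.
Hypothesis SL0 : S `<=` L0.
Hypothesis z_gt0 : 0 < z.
Hypothesis z_lt : z < 1 - (Num.sqrt 2)^-1.
Hypothesis tau_gt0 : 0 < tau.
Hypothesis xi_ge0 : 0 <= xi.
Hypothesis pen_lower : forall t, S t -> 2 * z * tau <= pen t.
Hypothesis Z_le : forall t t', S t -> S t' ->
  Z_real mu nu s t t' <= z * (h s t + h s t') + pen t + pen t' + z * tau * (xi + 1).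

Definition test_margin : R := 1 - (Num.sqrt 2)^-1 - z.
Definition test_constant : R := 2 + 6 / test_margin.
Definition risk_constant : R := (22 + 16 * test_constant) * (1 + (2 * z)^-1).

Lemma test_margin_gt0 : 0 < test_margin.
Proof. by rewrite /test_margin subr_gt0. Qed.

Lemma test_constant_ge2 : 2 <= test_constant.
Proof. by rewrite lerDl divr_ge0// ltW// test_margin_gt0. Qed.

Lemma risk_constant_gt0 : 0 < risk_constant.
Proof.
have := test_constant_ge2 => K2.
rewrite mulr_gt0//; first lra.
by rewrite addr_gt0// invr_gt0 mulr_gt0.
Qed.

Let Q (t : Tup) := h s t + pen t + tau * xi.

Lemma Q_ge0 t : S t -> 0 <= Q t.
Proof.
move=> St; have := pen_lower St; have := hellinger_ge0 mu s t.
have : 0 <= tau * xi by rewrite mulr_ge0// ltW.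
have : 0 < z * tau by rewrite mulr_gt0.
by rewrite /Q; lra.
Qed.

(** A point that beats [t] is not much farther from [s] than [t] is: the term
    [pen t'] coming from the process cancels with the one of the test, and
    [z < 1 - (sqrt 2)^-1] leaves a positive multiple of [h s t']. *)
Lemma preferred_is_close t t' : S t -> S t' -> (0 <= Ttest mu pen nu t t')%E ->
  h t t' <= test_constant * Q t.
Proof.
move=> St St' T0.
have sI := L0I L0s; have tI := L0I (SL0 St); have t'I := L0I (SL0 St').
have main := Ttest_ge0_le nu_fin sI tI t'I T0.
have tri := hellinger_triangle tI sI t'I; rewrite (hellingerC _ t s) in tri.
have := Z_le St St'; rewrite [z * tau * _]mulrDr mulr1 -[z * tau * xi]mulrA => ZZ.
apply: (preferred_arith _ z_gt0 z_lt _ _ _ (pen_lower St) ZZ main tri).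
- by rewrite invr_gt0 sqrtr_gt0.
- by rewrite mulr_gt0.
- by rewrite mulr_ge0// ltW.
- exact: hellinger_ge0.
Qed.

Context (Lambda : Type) (shat stil : Lambda -> Tup) (ltil lhat : Lambda).
Hypothesis L0shat : forall l, L0 (shat l).
Hypothesis sel : indirect_selection mu pen S tau nu shat stil ltil lhat.

Let S_stil l : S (stil l).
Proof. by have [/(_ l)[]] := sel. Qed.

Lemma Dcrit_le l :
  (Dcrit mu pen nu stil (stil l) <= (test_constant * Q (stil l))%:E)%E.
Proof.
have K2 := test_constant_ge2; have Q0 := Q_ge0 (S_stil l).
rewrite /Dcrit; case: ifPn => _; first by rewrite lee_fin mulr_ge0//; lra.
apply: ge_ereal_sup => _ [t' [[l' _ <-] _ T0] <-].
rewrite H2E; try exact/L0I/SL0/S_stil.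
by rewrite lee_fin preferred_is_close//; exact: S_stil.
Qed.

(** This is what allows [tau] to be bounded by a multiple of [Acrit]. *)
Lemma Acrit_ge (t : Tup) : L0 t -> ((2 * z * tau)%:E <= Acrit mu pen S t)%E.
Proof.
move=> tL; apply: le_ereal_inf_tmp => _ [t' St' <-].
rewrite H2E; [|exact: L0I|exact: L0I (SL0 St')].
by rewrite -EFinD lee_fin ler_wpDl ?hellinger_ge0// pen_lower.
Qed.

Lemma Acrit_fin_num (t : Tup) : L0 t -> Acrit mu pen S t \is a fin_num.
Proof.
move=> tL; rewrite ge0_fin_numE.
  apply: (@le_lt_trans _ _ (H2 mu t (stil ltil) + (pen (stil ltil))%:E)%E).
    by apply: ereal_inf_lbound; exists (stil ltil).
  by rewrite H2E -?EFinD ?ltry//; apply: L0I => //; apply: SL0; exact: S_stil.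
apply: le_trans (Acrit_ge tL).
by rewrite lee_fin !mulr_ge0// ltW.
Qed.

(** The point selected among the approximations is close to every approximation
    [stil l] in terms of [Q (stil l)]: whichever of the two beats the other, one
    of the criteria [Dcrit] bounds their distance. *)
Lemma selected_is_close l :
  h (stil l) (stil ltil) <= test_constant * Q (stil l) + tau.
Proof.
have K2 := test_constant_ge2; have Q0 := Q_ge0 (S_stil l).
have [_ dsel _] := sel; have tau0 := tau_gt0.
have tI l' : intensities mu (stil l') by exact/L0I/SL0/S_stil.
have [->|ne] := pselect (stil l = stil ltil).
  by rewrite hellingerxx addr_ge0 ?mulr_ge0 ?Q_ge0 ?(ltW tau_gt0)//; lra.
have [T0|T0] := Ttest_total nu_fin pen (tI l) (tI ltil).
  by apply: (le_trans (preferred_is_close (S_stil l) (S_stil ltil) T0)); lra.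
have inE : Eset mu pen nu stil (stil ltil) (stil l) by split=> //; exists l.
have : ((h (stil l) (stil ltil))%:E <= Dcrit mu pen nu stil (stil ltil))%E.
  rewrite /Dcrit; case: eqP => [e|_]; first by move: inE; rewrite e.
  by apply: ereal_sup_ubound; exists (stil l); rewrite // H2E// hellingerC.
move=> /le_trans /(_ (dsel l)) /le_trans.
move=> /(_ _ (leeD2r _ (Dcrit_le l))).
by rewrite -EFinD lee_fin.
Qed.

Lemma selected_estimator_risk l :
  (H2 mu s (shat lhat) <=
   risk_constant%:E * (H2 mu s (shat l) + Acrit mu pen S (shat l)
                       + (tau * xi)%:E))%E.
Proof.
have K2 := test_constant_ge2; have close := selected_is_close l.
have [/(_ l)[_ +] _ +] := sel.
have sI := L0I L0s; have hI l' : intensities mu (shat l') := L0I (L0shat l').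
have tI l' : intensities mu (stil l') by exact/L0I/SL0/S_stil.
move: (Acrit_ge (L0shat l)) (Acrit_fin_num (L0shat l)).
case: Acrit => // A; rewrite lee_fin => Age _.
rewrite !H2E// -!EFinD -EFinM !lee_fin => approx.
set e := ereal_inf _ => hsel.
have {hsel} hsel : h (shat lhat) (stil ltil) <= h (shat l) (stil ltil) + tau.
  rewrite -lee_fin; apply: le_trans hsel _; rewrite EFinD leeD2r//.
  by rewrite -H2E//; apply: ereal_inf_lbound; exists l.
have tr1 := hellinger_triangle sI (tI ltil) (hI lhat).
rewrite (hellingerC _ (stil ltil)) in tr1.
have tr2 := hellinger_triangle sI (tI l) (tI ltil).
have tr3 := hellinger_triangle (hI l) (tI l) (tI ltil).
have tr4 := hellinger_triangle sI (hI l) (tI l).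
apply: (risk_arith K2 z_gt0 tau_gt0 _ _ _ (pen_lower (S_stil l)) Age approx
  close tr1 hsel tr2 tr3 tr4).
- by rewrite mulr_ge0// ltW.
- exact: hellinger_ge0.
- exact: hellinger_ge0.
Qed.

End selected_estimator.

(** * From deviation bounds to expectations *)

Section expectation_from_tails.
Context d0 (Omega : measurableType d0) (R : realType) (P : probability Omega R).
Context (V I : Omega -> \bar R) (C tau B : R).
Hypothesis V_fin : forall w, V w \is a fin_num.
Hypothesis V_ge0 : forall w, (0 <= V w)%E.
Hypothesis I_ge0 : forall w, (0 <= I w)%E.
Hypothesis V_meas : measurable_fun setT V.
Hypothesis I_meas : measurable_fun setT I.
Hypothesis C_gt0 : 0 < C.
Hypothesis tau_gt0 : 0 < tau.
Hypothesis B_ge0 : 0 <= B.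

Definition tail_event (x : R) : set Omega :=
  [set w | (C%:E * (I w + (tau * x)%:E) <= V w)%E].

Lemma tail_event_measurable x : measurable (tail_event x).
Proof.
rewrite -[X in measurable X]setTI; apply: emeasurable_fun_le => //.
by apply: emeasurable_funM => //; exact: emeasurable_funD.
Qed.

(** The number of integers [j.+1] whose tail event occurs is at least the integer
    part of [(V - C * I) / (C * tau)]. *)
Lemma le_tail_count w :
  (V w <= C%:E * I w + (C * tau)%:E
          + (C * tau)%:E * \sum_(j <oo) (\1_(tail_event j.+1%:R) w)%:E)%E.
Proof.
have Ct : 0 < C * tau by rewrite mulr_gt0.
set T := (\sum_(j <oo) _)%E.
have T0 : (0 <= T)%E by apply: nneseries_ge0 => j _ _; rewrite lee_fin.
have CT0 : (0 <= (C * tau)%:E * T)%E by rewrite mule_ge0// lee_fin ltW.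
move: (V_fin w) (I_ge0 w); case eV: (V w) => [v| |]// _.
case eI: (I w) => [i| |]// i0; last first.
  have -> : (C%:E * +oo = +oo)%E by rewrite gt0_muley ?lte_fin.
  by rewrite addye ?leey// gt_eqF// (lt_le_trans _ CT0).
pose q := (v - C * i) / (C * tau).
have [q0|q0] := ltP q 0.
  apply: le_trans (leeDl _ CT0); rewrite -EFinM -EFinD lee_fin.
  by move: q0; rewrite /q ltr_pdivrMr// mul0r; lra.
have /andP[nq qn] := truncn_itv q0; set n := Num.trunc q in nq qn.
have nT : (n%:R%:E <= T)%E.
  apply: (@le_trans _ _ (\sum_(0 <= j < n) (\1_(tail_event j.+1%:R) w)%:E)%E).
    rewrite (eq_big_nat _ _ (F2 := fun=> 1%E)).
      by rewrite sumEFin big_const_nat subn0 iter_addr addr0.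
    move=> j /andP[_ jn]; rewrite indicE mem_set//=.
    rewrite /tail_event /= eV eI -EFinD -EFinM lee_fin.
    have jq : j.+1%:R <= q by rewrite (le_trans _ nq)// ler_nat.
    by move: jq; rewrite /q ler_pdivlMr//; lra.
  by apply: nneseries_lim_ge => j _; rewrite lee_fin.
apply: (@le_trans _ _ (C%:E * i%:E + (C * tau)%:E + (C * tau)%:E * n%:R%:E)%E).
  rewrite -!EFinM -!EFinD lee_fin.
  by move: qn; rewrite /q ltr_pdivrMr// -natr1; lra.
by rewrite leeD2l// lee_wpmul2l// lee_fin ltW.
Qed.

(** The first unit, where the tail bound is of no use, contributes [1]; the others
    contribute at most [B * expR (- j.+1%:R) <= B / 2 ^ j.+1] each. *)
Lemma expectation_le_of_tails :
  (forall n : nat, (P (tail_event n.+1%:R) <= (B * expR (- n.+1%:R))%:E)%E) ->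
  (\int[P]_w V w <= C%:E * (\int[P]_w I w + (tau * (1 + B))%:E))%E.
Proof.
move=> tails; have Ct : 0 <= C * tau by rewrite mulr_ge0// ltW.
pose T w := (\sum_(j <oo) (\1_(tail_event j.+1%:R) w)%:E : \bar R)%E.
have mi j : measurable_fun setT (fun w => (\1_(tail_event j.+1%:R) w)%:E : \bar R).
  by apply/measurable_EFinP; apply: measurable_indic; exact: tail_event_measurable.
have T0 w : (0 <= T w)%E by apply: nneseries_ge0 => j _ _; rewrite lee_fin.
have mT : measurable_fun setT T.
  by apply: (ge0_emeasurable_sum (P := xpredT)) => // j w _ _; rewrite lee_fin.
have intT : (\int[P]_w T w <= B%:E)%E.
  rewrite integral_nneseries//.
  apply: le_trans (epsilon_trick0 xpredT B_ge0); apply: lee_nneseries.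
    by move=> j _ _; apply: integral_ge0 => w _; rewrite lee_fin.
  move=> j _; rewrite integral_indic// ?setIT; last exact: tail_event_measurable.
  apply: le_trans (tails j) _.
  by rewrite lee_fin ler_wpM2l// expR_opp_nat_le.
have mCI : measurable_fun setT (fun w => C%:E * I w)%E.
  exact: emeasurable_funM.
have mCT : measurable_fun setT (fun w => (C * tau)%:E * T w)%E.
  exact: emeasurable_funM.
have CI0 w : (0 <= C%:E * I w)%E by rewrite mule_ge0// lee_fin ltW.
apply: (@le_trans _ _ (\int[P]_w (C%:E * I w + (C * tau)%:E + (C * tau)%:E * T w))%E).
  apply: ge0_le_integral => //.
  - by apply: emeasurable_funD => //; exact: emeasurable_funD.
  - by move=> w _; exact: le_tail_count.
rewrite ge0_integralD//; first last.
- by move=> w _; rewrite mule_ge0// lee_fin.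
- exact: emeasurable_funD.
- by move=> w _; rewrite adde_ge0// lee_fin.
rewrite ge0_integralD//.
rewrite !ge0_integralZl// ?lee_fin// ?(ltW C_gt0)//.
rewrite integral_cst//.
have PT : P setT = 1%E := probability_setT P.
rewrite [X in (_ + _ * X + _ <= _)%E]PT mule1.
have intI0 : (0 <= \int[P]_w I w)%E by apply: integral_ge0 => w _; exact: I_ge0.
have tauB0 : (0 <= (tau * (1 + B))%:E)%E.
  by rewrite lee_fin mulr_ge0 ?addr_ge0// ltW.
rewrite (ge0_muleDr _ intI0 tauB0).
rewrite -addeA leeD2l// -EFinM.
apply: (@le_trans _ _ ((C * tau)%:E + (C * tau)%:E * B%:E)%E).
  by rewrite leeD2l// lee_wpmul2l// lee_fin.
by rewrite -EFinM -EFinD lee_fin; lra.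
Qed.

End expectation_from_tails.

(** * The risk bound *)

Theorem theorem2 (R : realType) (z : R) (hz0 : 0 < z)
    (hz1 : z < 1 - (Num.sqrt 2)^-1) :
  exists C C' : R, 0 < C /\ 0 < C' /\
  forall
    (* the random measures *)
    (k : nat) (hk : (0 < k)%N)
    (d : 'I_k -> measure_display) (X : forall i, measurableType (d i))
    (mu : forall i, {measure set (X i) -> \bar R})
    (d0 : measure_display) (Omega : measurableType d0)
    (P : probability Omega R)
    (N : forall i, R.-ker Omega ~> X i)
    (hindep : independent_measures P N)
    (s : tuple_fun R X)
    (hmean : forall i (A : set (X i)), measurable A ->
       (\int[P]_w N i w A = \int[mu i]_(x in A) (s i x)%:E)%E /\
       (\int[mu i]_(x in A) (s i x)%:E < +oo)%E)
    (L0 : set (tuple_fun R X)) (hL0 : L0 `<=` intensities mu) (hs : L0 s)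
    (* the models and the estimators *)
    (M_index : countType) (Smodel : M_index -> set (tuple_fun R X))
    (hSmodel : forall m, Smodel m !=set0 /\ Smodel m `<=` L0)
    (Lambda : countType) (shat : Lambda -> Omega -> tuple_fun R X)
    (hshat : forall l, estimator mu N L0 (shat l))
    (hshatS : forall l w, (\bigcup_m Smodel m) (shat l w))
    (* the constants and the weights *)
    (M a b c tau : R) (hM : 0 < M) (ha : 0 < a) (hb : 0 <= b) (hc : 0 <= c)
    (htau : tau = 4 * (2 + c * z) / (a * z ^+ 2))
    (Delta : M_index -> R) (Sigma : R)
    (hSigma : \esum_(m in [set: M_index]) (expR (- Delta m))%:E = Sigma%:E)
    (hDelta : forall m, 1 <= Delta m)
    (* assumption (1) *)
    (hdev : forall y xi : R, 0 < y -> 0 < xi ->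
       (ereal_sup [set P [set w | xi%:E < Zproc mu s (fun i => N i w) p.1 p.2]
                  | p in Hball mu L0 s y `*` Hball mu L0 s y]
        <= (b * expR (- (a * xi ^+ 2 / (y ^+ 2 + c * xi))))%:E)%E)
    (* assumption (2) *)
    (Sm : M_index -> set (tuple_fun R X))
    (hSm : forall m, Sm m `<=` L0 /\ Hdiscrete mu L0 (Sm m))
    (eta : M_index -> R) (heta : forall m, 2^-1 <= eta m)
    (hcard : forall m (s' : tuple_fun R X) (r : R), L0 s' -> 2 * eta m <= r ->
       exists2 n : nat, (Sm m `&` Hball mu L0 s' (r * Num.sqrt tau) #= `I_n)%card &
                        n%:R <= M * expR (r ^+ 2 / 2))
    (* the penalty *)
    (S : set (tuple_fun R X)) (hS : S = \bigcup_m Sm m)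
    (pen : tuple_fun R X -> R) (hpen0 : forall t, S t -> 0 <= pen t)
    (hpen : forall t, S t ->
       z * tau * inf [set 4 * eta m ^+ 2 + Delta m | m in [set m | Sm m t]]
         <= pen t)
    (* the indirect selection procedure *)
    (stil : Lambda -> Omega -> tuple_fun R X) (ltil lhat : Omega -> Lambda)
    (hsel : forall w, indirect_selection mu pen S tau (fun i => N i w)
       (fun l => shat l w) (fun l => stil l w) (ltil w) (lhat w))
    (stilde : Omega -> tuple_fun R X)
    (hstilde : forall w, stilde w = shat (lhat w) w)
    (hstilde_est : estimator mu N L0 stilde),
  (forall xi : R, 0 < xi ->
     (P [set w | C%:E * (ereal_inf (range (fun l =>
                            H2 mu s (shat l w) + Acrit mu pen S (shat l w)))
                         + (tau * xi)%:E)
                 <= H2 mu s (stilde w)]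
      <= (Num.min (b * M ^+ 2 * Sigma ^+ 2 * expR (- xi)) 1)%:E)%E) /\
  (C'%:E * (\int[P]_w H2 mu s (stilde w))
   <= \int[P]_w ereal_inf (range (fun l =>
                   H2 mu s (shat l w) + Acrit mu pen S (shat l w)))
      + (tau * Num.max (b * M ^+ 2 * Sigma ^+ 2) 1)%:E)%E /\
  (\int[P]_w ereal_inf (range (fun l =>
                H2 mu s (shat l w) + Acrit mu pen S (shat l w)))
      + (tau * Num.max (b * M ^+ 2 * Sigma ^+ 2) 1)%:E
   <= ereal_inf (range (fun l =>
        \int[P]_w (H2 mu s (shat l w) + Acrit mu pen S (shat l w))))
      + (tau * Num.max (b * M ^+ 2 * Sigma ^+ 2) 1)%:E)%E.
Proof.
have rc0 := risk_constant_gt0 hz0 hz1.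
(* The deviation inequality is non-strict inside the probability: the additional
   [1] makes it fail at every good outcome. *)
set C := risk_constant z + 1; have C0 : 0 < C by rewrite /C addr_gt0.
exists C, (2 * C)^-1; split=> //; split; first by rewrite invr_gt0 mulr_gt0.
move=> k _ d X mu d0 Omega P N _ s hmean L0 L0I L0s I Smodel hSmodel.
move=> Lambda shat shatE shatS M a b c tau M0 a0 b0 c0 tauE Delta Sigma hSigma.
move=> Delta_ge dev Sm hSm eta eta_ge hcard S SE pen pen0 pen_ge.
move=> stil ltil lhat sel stilde stildeE stilde_est.
have tau0 : 0 < tau := tau_gt0 a0 c0 hz0 tauE.
have SmL0 m : Sm m `<=` L0 by have [] := hSm m.
have card_s m (r : R) := hcard m s r L0s.
have SL0 : S `<=` L0 by rewrite SE => t [m _ /SmL0].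
have countS : countable S.
  rewrite SE; apply: bigcup_countable => // m _.
  exact: (local_models_countable L0I L0s a0 c0 hz0 tauE SmL0 card_s).
have shatL0 l w : L0 (shat l w) := (shatE l).1 w.
have null_le : (P (infinite_mass N) <= 0)%E.
  rewrite infinite_mass_null// => i.
  by have [-> ->] := hmean i _ measurableT.
pose V w := H2 mu s (stilde w).
pose A w := ereal_inf (range (fun l => H2 mu s (shat l w) + Acrit mu pen S (shat l w)))%E.
have V_meas : measurable_fun setT V by exact: (measurable_H2_estimator L0I stilde_est L0s).
have term_meas l : measurable_fun setT
    (fun w => H2 mu s (shat l w) + Acrit mu pen S (shat l w))%E.
  apply: emeasurable_funD.
    exact: (measurable_H2_estimator L0I (shatE l) L0s).
  exact: (measurable_Acrit_estimator L0I pen (shatE l) SL0 countS).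
have A_meas : measurable_fun setT A.
  by apply: (measurable_fun_ereal_inf (D := setT)) => // l _; exact: term_meas.
have VE w : V w = (hellinger mu s (stilde w))%:E.
  by rewrite /V H2E//; apply: L0I => //; exact: stilde_est.1.
have V_fin w : V w \is a fin_num by rewrite VE.
have V_ge0 w : (0 <= V w)%E by rewrite VE lee_fin hellinger_ge0.
have H2_ge0 t t' : L0 t -> L0 t' -> (0 <= H2 mu t t')%E.
  by move=> /L0I tI /L0I t'I; rewrite H2E// lee_fin hellinger_ge0.
have term_ge0 l w : (0 <= H2 mu s (shat l w) + Acrit mu pen S (shat l w))%E.
  rewrite adde_ge0 ?H2_ge0//; apply: le_ereal_inf_tmp => _ [t' St' <-].
  by rewrite adde_ge0 ?H2_ge0 ?lee_fin ?pen0//; exact: SL0.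
have A_ge0 w : (0 <= A w)%E by apply: le_ereal_inf_tmp => _ [l _ <-].
set B := b * M ^+ 2 * Sigma ^+ 2.
have B0 : 0 <= B by rewrite /B mulr_ge0 ?sqr_ge0// mulr_ge0 ?sqr_ge0.
have good w xi : 0 < xi -> ~ infinite_mass N w ->
    ~ bad_event mu N s L0 Sm eta Delta tau z xi w ->
    ~ tail_event V A C tau xi w.
  move=> xi0 /not_infinite_mass Nfin nbad; rewrite /tail_event /= VE.
  set v := hellinger _ _ _.
  have xt : 0 < tau * xi by rewrite mulr_gt0.
  have risk l : (v%:E <= (risk_constant z)%:E *
      (H2 mu s (shat l w) + Acrit mu pen S (shat l w) + (tau * xi)%:E))%E.
    rewrite -VE /V stildeE.
    apply: (selected_estimator_risk Nfin L0I L0s SL0 hz0 hz1 tau0 (ltW xi0)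
      _ _ (fun l => shatL0 l w) (sel w)).
    - exact: (pen_lower a0 c0 hz0 tauE eta_ge Delta_ge SE pen_ge).
    - move=> t t' St St'.
      exact: (not_bad_event_pen L0I L0s a0 c0 hz0 tauE SmL0 Delta_ge
        SE pen_ge xi0 Nfin nbad St St').
  have Alow : ((v / risk_constant z - tau * xi)%:E <= A w)%E.
    apply: le_ereal_inf_tmp => _ [l _ <-].
    have := risk l; case: (_ + Acrit _ _ _ _)%E (term_ge0 l w) => [x| |]//.
      rewrite -EFinD -EFinM !lee_fin => _ vx.
      by rewrite lerBlDr ler_pdivrMr// mulrC.
    by move=> _ _; rewrite leey.
  move: Alow (A_ge0 w); case: (A w) => [x| |]//.
    rewrite -EFinD -EFinM !lee_fin lerBlDr ler_pdivrMr// => vx x0; apply/negP.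
    have xx : 0 < x + tau * xi by rewrite ltr_wpDl.
    by rewrite -ltNge (le_lt_trans vx)// mulrC (ltr_pM2r xx) /C ltrDl.
  by move=> _ _; rewrite addye// gt0_muley ?lte_fin// leye_eq.
have tail xi : 0 < xi -> (P (tail_event V A C tau xi) <= (B * expR (- xi))%:E)%E.
  move=> xi0.
  have mF := tail_event_measurable C tau V_meas A_meas xi.
  have mI := infinite_mass_measurable N.
  have mB : measurable (bad_event mu N s L0 Sm eta Delta tau z xi).
    exact: (bad_event_measurable N L0I z SmL0 Delta_ge card_s).
  apply: (@le_trans _ _ (P (bad_event mu N s L0 Sm eta Delta tau z xi
                            `|` infinite_mass N))).
    apply: le_measure; rewrite ?inE//; first exact: measurableU.
    move=> w Fw; apply: contrapT => nw; apply: (good w xi xi0) Fw => hw.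
      by apply: nw; right.
    by apply: nw; left.
  apply: le_trans (measureU2 _ mB mI) _; rewrite -[leRHS]adde0; apply: leeD.
    exact: (bad_event_prob L0I a0 b0 c0 hz0 tauE dev SmL0 Delta_ge card_s).
  exact: null_le.
split; last split.
- move=> xi xi0; have [_|_] := leP (B * expR (- xi)) 1; first exact: tail.
  by apply: probability_le1; exact: (tail_event_measurable C tau V_meas A_meas xi).
- have expected := expectation_le_of_tails V_fin V_ge0 A_ge0 V_meas A_meas C0
    tau0 B0 (fun n => tail n.+1%:R (ltr0Sn R n)).
  have i0 : 0 <= (2 * C)^-1 by rewrite invr_ge0 mulr_ge0// ltW.
  apply: (@le_trans _ _ ((2 * C)^-1%:E *
      (C%:E * (\int[P]_w A w + (tau * (1 + B))%:E)))%E).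
    exact: lee_wpmul2l.
  rewrite muleA -EFinM; have -> : (2 * C)^-1 * C = 2^-1 by field; rewrite gt_eqF.
  have : (0 <= \int[P]_w A w)%E by apply: integral_ge0 => w _; exact: A_ge0.
  rewrite /A; case: (integral _ _ _) => [x| |]//.
    rewrite -!EFinD -EFinM !lee_fin => x0.
    have m1 : B <= Num.max B 1 by rewrite le_max lexx.
    have m2 : 1 <= Num.max B 1 by rewrite le_max lexx orbT.
    have : tau * (1 + B) <= tau * (2 * Num.max B 1).
      by rewrite ler_wpM2l// ?(ltW tau0)//; lra.
    lra.
  by move=> _; rewrite [leRHS]addye// leey.
- rewrite leeD2r//; apply: le_ereal_inf_tmp => _ [l _ <-].
  apply: (ge0_le_integral P measurableT (fun w _ => A_ge0 w) A_meas (term_meas l)).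
  by move=> w _; apply: ereal_inf_lbound; exists l.
Qed.
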